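(* Define a degree-$15$ Belyi map $\mathbb{P}^1_x\to\mathbb{P}^1_\zeta$ by $$\zeta_{1,4}(x)=\frac14\,\frac{x(1-5x)^4(5+6x+5x^2)^4}{(1-x)^5(1+10x+5x^2)^5}=\left.\frac{5^5}{4^4}\frac{s^4}{(1-s)^5}\right|_{s=\frac{-(1-5x)(5+6x+5x^2)}{64\,x}}$$ $$=1-\frac{(4-5x-10x^2-5x^3)(1-55x-5x^2-5x^3)^2(1+5x^2+10x^3)^2}{4(1-x)^5(1+10x+5x^2)^5}.$$ Then in a neighborhood of $x=0$, $$(1-x)^{1/4}(1+10x+5x^2)^{1/4}\;{}_4F_3\left(\begin{array}{c}-\frac1{20},\frac3{20},\frac7{20},\frac{11}{20}\\ \frac14,\frac12,\frac34\end{array}\mid\zeta_{1,4}(x)\right)$$ $$=\left\{\tfrac12-\tfrac5{16}x-\tfrac58x^2-\tfrac5{16}x^3+\tfrac12\left[1-\tfrac54x-\tfrac52x^2-\tfrac54x^3\right]^{1/2}\right\}^{1/4}.$$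
   Context: A Belyi map is a holomorphic map to $\mathbb{P}^1_\zeta$ ramified only over $\zeta=0,1,\infty$. Fractional powers are principal (bases near $1$). ${}_4F_3(a_1,\dots,a_4;b_1,b_2,b_3;\zeta)=\sum_{k\ge0}\frac{(a_1)_k\cdots(a_4)_k}{(b_1)_k(b_2)_k(b_3)_k\,k!}\zeta^k$ with $(c)_k=c(c+1)\cdots(c+k-1)$. *)

(* Defs.v *)
From HB Require Import structures.
From mathcomp Require Import all_boot all_order all_algebra.
From mathcomp Require Import all_classical all_reals all_analysis.
From mathcomp Require Import complex.

Set Implicit Arguments.
Unset Strict Implicit.
Unset Printing Implicit Defensive.
Import Order.TTheory GRing.Theory Num.Theory numFieldNormedType.Exports.
Local Open Scope classical_set_scope.
Local Open Scope ring_scope.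
Local Open Scope complex_scope.

(* R[i] with the topology and norm every numFieldType carries, as a normed
   space over itself: [derivable] and ['D_1] on R[i] -> R[i] are then complex
   differentiability and the complex derivative. *)
HB.instance Definition _ (R : rcfType) := NormedModule.copy R[i] R[i]^o.

Section FractionalPowers.
Context {R : realType}.
Implicit Types z : R[i].

Definition cexp z : R[i] :=
  (expR (complex.Re z))%:C * (cos (complex.Im z) +i* sin (complex.Im z)).

(* The principal argument, in ]- pi, pi] for z != 0. *)
Definition carg z : R :=
  let t := acos (complex.Re z / ComplexField.Normc.normc z) in
  if 0 <= complex.Im z then t else - t.

Definition clog z : R[i] := ln (ComplexField.Normc.normc z) +i* carg z.

(* Principal power with real exponent; at 0 it follows the convention of powR. *)
Definition cpow z (a : R) : R[i] :=
  if z == 0 then (a == 0)%:R else cexp (a%:C * clog z).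

End FractionalPowers.

Section Hypergeometric.
Context {R : realType}.

Definition rising (c : R[i]) (k : nat) : R[i] := \prod_(j < k) (c + j%:R).

Definition hyp43_term (a1 a2 a3 a4 b1 b2 b3 z : R[i]) : nat -> R[i] := fun k =>
  rising a1 k * rising a2 k * rising a3 k * rising a4 k
  / (rising b1 k * rising b2 k * rising b3 k * k`!%:R) * z ^+ k.

Definition hyp43_cvg (a1 a2 a3 a4 b1 b2 b3 z : R[i]) : Prop :=
  cvgn (series (hyp43_term a1 a2 a3 a4 b1 b2 b3 z)).

(* Meaningful only under [hyp43_cvg]. *)
Definition hyp43 (a1 a2 a3 a4 b1 b2 b3 z : R[i]) : R[i] :=
  limn (series (hyp43_term a1 a2 a3 a4 b1 b2 b3 z)).

End Hypergeometric.

(* The complex projective line, as a topological space: [Some z] is the affine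
   point z and [None] is infinity. *)
Notation P1 R := (one_point_compactification R[i]).

Section ProjectiveLine.
Context {R : realType}.

(* The two standard charts: z |-> z, and z |-> 1/z centred at infinity. *)
Definition chart (at_infty : bool) (z : R[i]) : P1 R :=
  if at_infty then (if z == 0 then None else Some z^-1) else Some z.

(* Inverse of [chart b] on [range (chart b)]; the value at the one remaining
   point is junk. *)
Definition coord (at_infty : bool) (p : P1 R) : R[i] :=
  if p is Some z then (if at_infty then z^-1 else z) else 0.

(* Since f is continuous, [coord c \o f \o chart b] avoids the junk value of
   [coord c] in a neighborhood of each point at which it is considered. *)
Definition holomorphic (f : P1 R -> P1 R) : Prop :=
  continuous f /\
  forall (b c : bool) (z : R[i]), range (chart c) (f (chart b z)) ->
    derivable (coord c \o f \o chart b) z 1.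

(* Ramification index > 1: the derivative vanishes in local coordinates (for
   holomorphic f this does not depend on the charts). *)
Definition ramified_at (f : P1 R -> P1 R) (p : P1 R) : Prop :=
  exists (b c : bool) (z : R[i]),
    [/\ chart b z = p, range (chart c) (f p) &
        'D_1 (coord c \o f \o chart b) z = 0].

Definition belyi (f : P1 R -> P1 R) : Prop :=
  holomorphic f /\
  forall p, ramified_at f p -> [\/ f p = Some 0, f p = Some 1 | f p = None].

(* The degree of a holomorphic map P^1 -> P^1 is the number of points in each
   unramified fibre. *)
Definition has_degree (f : P1 R -> P1 R) (d : nat) : Prop :=
  forall q, (forall p, f p = q -> ~ ramified_at f p) ->
    (f @^-1` [set q] #= `I_d)%card.

End ProjectiveLine.

Section Zeta14.
Context {R : realType}.
Implicit Types x : R[i].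

Definition zeta14_den x : R[i] :=
  (1 - x) ^+ 5 * (1 + 10 * x + 5 * x ^+ 2) ^+ 5.

Definition zeta14 x : R[i] :=
  1 / 4 * (x * (1 - 5 * x) ^+ 4 * (5 + 6 * x + 5 * x ^+ 2) ^+ 4
           / zeta14_den x).

(* The map of projective lines given by the rational function [zeta14]: its
   numerator does not vanish at the zeros of [zeta14_den], and has degree 13
   against 15 for the denominator, whence the value 0 at infinity. *)
Definition zeta14_P1 (p : P1 R) : P1 R :=
  if p is Some x then
    if zeta14_den x == 0 then None else Some (zeta14 x)
  else Some 0.

End Zeta14.

(* Main.v *)
(* Let u(z) be the root near 1 of u^5 - u + z = 0. Its Taylor coefficients are
   generalized binomials (Rothe-Hagen), and those of index 4m are the
   coefficients of the 4F3 after substituting z^4 = (256/3125) zeta; hence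
   4F3(zeta) is the mean of u(i^k z), k = 0..3. When zeta = zeta_{1,4}(x) the
   quintic is solved by radicals: with E = (1-x)(1+10x+5x^2),
   N = (1-5x)(5+6x+5x^2), w^2 = 1 - 5/4 x - 5/2 x^2 - 5/4 x^3, m = 1 + w,
   b^4 = m^2/(4E), theta^4 = x/(5m^2) and z = 4bN theta/(5E), a root is
     b (1 - theta - 5/2 (1+x) theta^2 - 5 m theta^3),
   and its mean over theta -> i^k theta is b, the right-hand side divided by
   the prefactor (the radicand there is (m/2)^2).
   For the covering itself, every composite of zeta_{1,4} with charts is a
   quotient of two polynomials without common root whose Wronskian factors
   explicitly, so all critical values are 0, 1 or infinity. *)
Require Import Defs.
From HB Require Import structures.
From mathcomp Require Import all_boot all_order all_algebra.
From mathcomp Require Import all_classical all_reals all_analysis.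
From mathcomp Require Import separable complex finmap ring lra zify.
Import Order.TTheory GRing.Theory Num.Theory numFieldNormedType.Exports.
Local Open Scope classical_set_scope.
Local Open Scope ring_scope.
Local Open Scope complex_scope.

Set Implicit Arguments.
Unset Strict Implicit.
Unset Printing Implicit Defensive.

(** * Rothe-Hagen coefficients: Pascal recurrence and convolution *)

Lemma poly_nat_roots_eq0 (K : numFieldType) (p : {poly K}) :
  (forall n : nat, p.[n%:R] = 0) -> p = 0.
Proof.
move=> p0; apply/eqP/negPn/negP => pn0.
have := @max_poly_roots K p [seq k%:R | k <- iota 0 (size p)] pn0.
rewrite size_map size_iota ltnn => h; apply/notF/h.
  by apply/allP => x /mapP[k _ ->]; apply/eqP.
by rewrite map_inj_uniq ?iota_uniq // => i j /eqP; rewrite eqr_nat => /eqP.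
Qed.

Section RotheHagen.
Context {K : numFieldType}.
Variable t : K.

(* r / (r + t n) * binomial (r + t n) n, as a polynomial in r: the n-th
   coefficient of the r-th power of the series B with B = 1 + z B^t. *)
Definition rothe (n : nat) (r : K) : K :=
  if n is 0 then 1 else
  r / n`!%:R * \prod_(1 <= j < n) (r + t * n%:R - j%:R).

Lemma rotheE n r : (0 < n)%N ->
  rothe n r = r / n`!%:R * \prod_(1 <= j < n) (r + t * n%:R - j%:R).
Proof. by case: n. Qed.

Definition rothe_poly (n : nat) : {poly K} :=
  if n is 0 then 1 else
  (n`!%:R)^-1 *: ('X * \prod_(1 <= j < n) ('X + (t * n%:R - j%:R)%:P)).

Lemma horner_rothe_poly n r : (rothe_poly n).[r] = rothe n r.
Proof.
case: n => [|n]; first by rewrite /= hornerC.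
rewrite /rothe_poly /rothe hornerZ hornerM hornerX mulrA [_^-1 * r]mulrC.
congr (_ * _); rewrite horner_prod; apply: eq_bigr => j _.
by rewrite hornerD hornerX hornerC addrA.
Qed.

Lemma rothe0 n : rothe n 0 = (n == 0)%:R.
Proof. by case: n => //= n; rewrite !mul0r. Qed.

(** For the generating series this is B^r - B^(r-1) = z B^(r-1+t), a consequence of B = 1 + z B^t.
    The three products share the factors [w], so only an identity between the remaining factors is
    left. *)
Lemma rothe_pascal n r :
  rothe n.+1 r - rothe n.+1 (r - 1) = rothe n (r + t - 1).
Proof.
case: n => [|n].
  by rewrite /rothe !big_geq //= invr1; ring.
set q := r + t * n.+2%:R.
set w := \prod_(2 <= j < n.+2) (q - j%:R).
have fn0 : (n.+1)`!%:R != 0 :> K by rewrite pnatr_eq0 -lt0n fact_gt0.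
have -> : rothe n.+2 r = r / (n.+2)`!%:R * ((q - 1) * w).
  by rewrite /rothe big_ltn.
have -> : rothe n.+2 (r - 1) = (r - 1) / (n.+2)`!%:R * (w * (q - n.+2%:R)).
  rewrite /rothe; congr (_ * _).
  rewrite big_add1 big_nat_recr //= /w big_add1; congr (_ * _).
    rewrite big_add1 /=; apply: eq_bigr => j _; rewrite /q -(natr1 j.+1); ring.
  by rewrite /q -(natr1 n.+1); ring.
have -> : rothe n.+1 (r + t - 1) = (r + t - 1) / (n.+1)`!%:R * w.
  rewrite /rothe /w [in RHS]big_add1 /=; congr (_ * _); apply: eq_bigr => j _.
  by rewrite /q -(natr1 n.+1) -(natr1 j); ring.
rewrite factS natrM /q -(natr1 n.+1).
have n2 : n.+1%:R + 1 != 0 :> K by rewrite natr1 pnatr_eq0.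
move: (n.+1%:R) ((n.+1)`!%:R) fn0 n2 => /= N f fn0 n2.
by field; rewrite fn0 n2.
Qed.

(** Coefficient form of B^r B^s = B^(r+s). The difference of the two sides is a polynomial in [r];
    by the Pascal recurrence and induction on [n] it has period 1, and it vanishes at 0, hence at
    every natural number, hence identically. *)
Lemma rothe_convolution n r s :
  \sum_(i < n.+1) rothe i r * rothe (n - i)%N s = rothe n (r + s).
Proof.
elim: n r s => [|n IHn] r s; first by rewrite big_ord_recl big_ord0 /= addr0 mul1r.
pose D := \sum_(i < n.+2) rothe_poly i * (rothe (n.+1 - i)%N s)%:P
          - (rothe_poly n.+1 \Po ('X + s%:P)).
have DE a : D.[a] = \sum_(i < n.+2) rothe i a * rothe (n.+1 - i)%N s
                    - rothe n.+1 (a + s).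
  rewrite /D hornerD hornerN horner_comp hornerD hornerX hornerC.
  rewrite horner_rothe_poly horner_sum; congr (_ - _).
  by apply: eq_bigr => i _; rewrite hornerM hornerC horner_rothe_poly.
have D1 a : D.[a] = D.[a - 1].
  apply/eqP; rewrite -subr_eq0 !DE.
  have swap u v u' v' : u - v - (u' - v') = (u - u') - (v - v') :> K by ring.
  rewrite swap.
  rewrite -sumrB big_ord_recl /= subrr add0r.
  under eq_bigr => i _ do rewrite /bump /= add1n subSS -mulrBl rothe_pascal.
  rewrite IHn (_ : a - 1 + s = a + s - 1); last by ring.
  by rewrite rothe_pascal subr_eq0; apply/eqP; congr (rothe _ _); ring.
have Dn k : D.[k%:R] = 0.
  elim: k => [|k IHk]; last by rewrite D1 -natr1 addrK.
  rewrite DE add0r big_ord_recl rothe0 mul1r subn0 big1 ?addr0 ?subrr // => i _.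
  by rewrite rothe0 mul0r.
have := DE r; rewrite (poly_nat_roots_eq0 Dn) horner0 => /esym/eqP.
by rewrite subr_eq0 => /eqP.
Qed.

End RotheHagen.

(** * The power series root of u^5 - u + z = 0 and its truncations *)

Section TrinomialSeries.
Context {K : numFieldType}.
Implicit Types (p q : {poly K}) (x y z : K).

(** For t = 5/4 the series u = B^(-1/4) satisfies u - u^5 = B^(-1/4) - B^(-5/4) = z; these are its
    Taylor coefficients. *)
Definition tri_coef (k : nat) : K := rothe (5 / 4) k (- (1 / 4)).

Definition tri_poly (N : nat) : {poly K} := \poly_(k < N) tri_coef k.

Lemma coef_tri_poly_exp N m n : (n < N)%N ->
  (tri_poly N ^+ m.+1)`_n = rothe (5 / 4) n (m.+1%:R * - (1 / 4)).
Proof.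
elim: m n => [|m IHm] n nN; first by rewrite expr1 mulr1n mul1r coef_poly nN.
have -> : m.+2%:R * - (1 / 4) = - (1 / 4) + m.+1%:R * - (1 / 4) :> K.
  by rewrite -(natr1 m.+1); ring.
rewrite exprS coefM -rothe_convolution.
apply: eq_bigr => -[i /= ilen] _; rewrite coef_poly IHm ?(leq_ltn_trans _ nN) //.
exact: leq_subr.
Qed.

Lemma coef_tri_poly_eq N n : (n < N)%N ->
  (tri_poly N ^+ 5 - tri_poly N + 'X)`_n = 0.
Proof.
move=> nN; rewrite !coefE coef_tri_poly_exp // nN /tri_coef.
case: n nN => [|n] nN; first by rewrite /= subrr add0r.
have -> : 5 * - (1 / 4) = - (1 / 4) - 1 :> K by field.
(* At r = -1/4 and t = 5/4 the shifted argument r + t - 1 is 0, so the Pascal right-hand side is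
   nonzero only for the coefficient of z^1, where ['X] cancels it. *)
rewrite -opprB rothe_pascal (_ : _ + _ - 1 = 0) ?rothe0; last by field.
by case: n nN => [|n] nN /=; rewrite addNr.
Qed.

(** For k > 0 each factor of the product is nonnegative and at most 2k - j, so the product is at
    most k! C(2k, k); and C(2k, k) <= 4^k, being one term of the expansion of (1 + 1)^(2k). *)
Lemma norm_tri_coef k : `|tri_coef k| <= 4 ^+ k.
Proof.
case: k => [|k]; first by rewrite normr1 expr0.
rewrite /tri_coef /rothe; set P := \prod_(_ <= _ < _) _.
have PP : `|P| <= (\prod_(1 <= j < k.+1) (2 * k.+1 - j)%N)%:R.
  rewrite /P normr_prod natr_prod.
  rewrite big_nat_cond [leRHS]big_nat_cond; apply: ler_prod => j.
  rewrite andbT => /andP[j1 jk]; rewrite normr_ge0 /= natrB; last by lia.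
  have jk' : j%:R <= k%:R :> K by rewrite ler_nat -ltnS.
  rewrite ger0_norm.
    rewrite lerD2r natrM -subr_ge0.
    have -> : 2%:R * k.+1%:R - (- (1 / 4) + 5 / 4 * k.+1%:R)
      = 3 / 4 * k.+1%:R + 1 / 4 :> K by field.
    by rewrite addr_ge0 ?mulr_ge0 ?invr_ge0 ?ler0n.
  have -> : - (1 / 4) + 5 / 4 * k.+1%:R - j%:R
    = (k%:R - j%:R) + (1 + 1 / 4 * k%:R) :> K by rewrite -natr1; field.
  by rewrite addr_ge0 ?subr_ge0 // addr_ge0 ?mulr_ge0 ?invr_ge0 ?ler0n.
have PF : (\prod_(1 <= j < k.+1) (2 * k.+1 - j) <= 4 ^ k.+1 * (k.+1)`!)%N.
  apply: (@leq_trans ('C(2 * k.+1, k.+1) * (k.+1)`!)%N).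
    rewrite bin_ffact ffact_prod.
    by rewrite -(big_mkord xpredT (fun i => 2 * k.+1 - i)%N) [leqRHS]big_ltn // leq_pmull.
  rewrite leq_mul2r; apply/orP; right.
  rewrite -[4%N]/(2 ^ 2)%N -expnM.
  have := Pascal 1 1 (2 * k.+1); rewrite addn1 => ->.
  have kk : (k.+1 < (2 * k.+1).+1)%N by lia.
  by rewrite (bigD1 (Ordinal kk)) //= !exp1n !muln1 leq_addr.
have f0 : 0 < (k.+1)`!%:R :> K by rewrite ltr0n fact_gt0.
rewrite normrM normrM normfV normrN (ger0_norm (ltW f0)).
rewrite [X in X / _ * _]ger0_norm ?mulr_ge0 ?invr_ge0 ?ler0n //.
apply: (@le_trans _ _ (1 / (k.+1)`!%:R * (4 ^ k.+1 * (k.+1)`!)%:R)).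
  apply: ler_pM => //.
  - by rewrite ler_pM2r ?invr_gt0 // ler_pdivrMr ?ltr0n // mul1r ler1n.
  - by apply: le_trans PP _; rewrite ler_nat.
by rewrite natrM natrX div1r mulrC mulfK ?gt_eqF.
Qed.

(** Each of the n + 1 terms of the convolution is at most b^n, and n + 1 <= 2^n. *)
Lemma norm_coefM_geometric p q (a b : K) : 0 <= a -> a <= b ->
  (forall n, `|p`_n| <= a ^+ n) -> (forall n, `|q`_n| <= b ^+ n) ->
  forall n, `|(p * q)`_n| <= (2 * b) ^+ n.
Proof.
move=> a0 ab pa qb n; rewrite coefM; apply: le_trans (ler_norm_sum _ _ _) _.
apply: (@le_trans _ _ (\sum_(i < n.+1) b ^+ n)).
  apply: ler_sum => -[i /= ilen] _; rewrite normrM.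
  rewrite -[in leRHS](subnKC (m := i) (n := n)) // exprD ler_pM //.
  by apply: le_trans (pa i) _; rewrite lerXn2r // nnegrE (le_trans a0).
rewrite sumr_const card_ord exprMn -[_ *+ n.+1]mulr_natl ler_wpM2r ?exprn_ge0 ?(le_trans a0) //.
by rewrite -natrX ler_nat ltn_expl.
Qed.

(** Writing u^5 = u (u^2)^2 takes three products, so the ratio 4 of [norm_tri_coef] doubles three
    times. *)
Lemma norm_coef_tri_poly5 N n : `|(tri_poly N ^+ 5)`_n| <= 32 ^+ n.
Proof.
have h1 k : `|(tri_poly N)`_k| <= 4 ^+ k.
  rewrite coef_poly; case: ifP => _; first exact: norm_tri_coef.
  by rewrite normr0 exprn_ge0.
have h2 k : `|(tri_poly N * tri_poly N)`_k| <= 8 ^+ k.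
  have -> : 8 = 2 * 4 :> K by rewrite -natrM.
  exact: (norm_coefM_geometric (ler0n _ _) (lexx _) h1 h1).
have h4 k : `|(tri_poly N * tri_poly N * (tri_poly N * tri_poly N))`_k| <= 16 ^+ k.
  have -> : 16 = 2 * 8 :> K by rewrite -natrM.
  exact: (norm_coefM_geometric (ler0n _ _) (lexx _) h2 h2).
have -> : tri_poly N ^+ 5 =
    tri_poly N * (tri_poly N * tri_poly N * (tri_poly N * tri_poly N)) by ring.
have -> : 32 = 2 * 16 :> K by rewrite -natrM.
by apply: (norm_coefM_geometric _ _ h1 h4); rewrite ?ler0n ?ler_nat.
Qed.

Lemma sum_half_ge (N M : nat) :
  \sum_(0 <= i < M | (N <= i)%N) (1 / 2) ^+ i <= 2 * (1 / 2) ^+ N :> K.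
Proof.
have h0 n : 0 <= (1 / 2) ^+ n :> K by rewrite exprn_ge0 // mulr_ge0 ?invr_ge0 ?ler0n.
(* Adding the missing tail 2 (1/2)^max(N, M) turns the bound into an equality, on which the
   induction on [M] runs. *)
suff <- : \sum_(0 <= i < M | (N <= i)%N) (1 / 2) ^+ i
   + 2 * (1 / 2) ^+ (maxn N M) = 2 * (1 / 2) ^+ N :> K.
  by rewrite lerDl mulr_ge0.
elim: M => [|M IHM]; first by rewrite big_geq // add0r maxn0.
rewrite big_mkcond big_nat_recr //= -big_mkcond /= -IHM -addrA; congr (_ + _).
have [NM|MN] := leqP N M.
  rewrite (maxn_idPr (leqW NM)) exprS; by field.
by rewrite add0r (maxn_idPl MN).
Qed.

(** The coefficients of the residue vanish below [N] and are at most 32^n from there on, so for |z|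
    <= 1/64 a geometric tail of ratio 1/2 is left. *)
Lemma tri_poly_residue N z : (1 < N)%N -> `|z| <= 1 / 64 ->
  `|(tri_poly N).[z] ^+ 5 - (tri_poly N).[z] + z| <= 2 * (1 / 2) ^+ N.
Proof.
move=> N1 z64; set e := tri_poly N ^+ 5 - tri_poly N + 'X.
have -> : (tri_poly N).[z] ^+ 5 - (tri_poly N).[z] + z = e.[z].
  by rewrite !hornerE.
rewrite horner_coef -(big_mkord xpredT (fun i => e`_i * z ^+ i)).
apply: le_trans (ler_norm_sum _ _ _) (le_trans _ (sum_half_ge N (size e))).
rewrite [leRHS]big_mkcond /=; apply: ler_sum => n _.
case: leqP => [Nn|nN]; last by rewrite coef_tri_poly_eq // mul0r normr0.
rewrite normrM normrX.
have -> : e`_n = (tri_poly N ^+ 5)`_n.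
  rewrite /e coefD coefB coefX coef_poly ltnNge Nn subr0.
  by rewrite gtn_eqF ?addr0 //; lia.
apply: (@le_trans _ _ (32 ^+ n * (1 / 64) ^+ n)).
  by rewrite ler_pM ?exprn_ge0 ?norm_coef_tri_poly5 // lerXn2r ?nnegrE // mulr_ge0 ?invr_ge0 ?ler0n.
by rewrite -exprMn (_ : 32 * (1 / 64) = 1 / 2) //; field.
Qed.

(** Since 4|z| <= 1/2, the terms of index at least 1 sum to at most 4|z| (1 + 1/2 + 1/4 + ...). *)
Lemma tri_poly_near1 N z : (0 < N)%N -> 8 * `|z| <= 1 ->
  `|(tri_poly N).[z] - 1| <= 8 * `|z|.
Proof.
case: N => // N _ z8; rewrite horner_poly big_ord_recl expr0 mulr1 /= addrC addKr.
apply: le_trans (ler_norm_sum _ _ _) _.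
apply: (@le_trans _ _ (4 * `|z| * \sum_(0 <= i < N | (0 <= i)%N) (1 / 2) ^+ i)).
  rewrite big_mkord mulr_sumr; apply: ler_sum => i _.
  rewrite normrM normrX; apply: (@le_trans _ _ (4 ^+ i.+1 * `|z| ^+ i.+1)).
    by rewrite ler_wpM2r ?exprn_ge0 //; exact: (norm_tri_coef i.+1).
  rewrite -exprMn exprS ler_wpM2l ?mulr_ge0 // lerXn2r ?nnegrE ?mulr_ge0 ?invr_ge0 ?ler0n //.
  by rewrite ler_pdivlMr ?ltr0n // mulrAC -natrM.
have -> : 8 * `|z| = 4 * `|z| * 2 by ring.
by rewrite ler_wpM2l ?mulr_ge0 // (le_trans (sum_half_ge _ _)) // expr0 mulr1.
Qed.

Lemma near1_mul (x y a b : K) : `|x - 1| <= a -> `|y - 1| <= b -> a <= 1 ->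
  `|x * y - 1| <= a + 2 * b.
Proof.
move=> xa yb a1.
have -> : x * y - 1 = (x - 1) + (x - 1 + 1) * (y - 1) by ring.
apply: le_trans (ler_normD _ _) (lerD xa _).
rewrite normrM ler_pM //; apply: le_trans (ler_normD _ _) _.
by rewrite normr1 (_ : 2 = 1 + 1) -?natrD // lerD2r (le_trans xa).
Qed.

(* The difference quotient of u^5 - u + z is close to 4 near u = 1. *)
Lemma quintic_root_stable (u v z : K) :
  `|u - 1| <= 1 / 100 -> `|v - 1| <= 1 / 100 -> v ^+ 5 - v + z = 0 ->
  `|u - v| <= `|u ^+ 5 - u + z|.
Proof.
move=> u1 v1 vz.
have c0 n : 0 <= n%:R / 100 :> K by rewrite mulr_ge0 ?invr_ge0 ?ler0n.
have c1 n : (n <= 100)%N -> n%:R / 100 <= 1 :> K.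
  by move=> n100; rewrite ler_pdivrMr ?ltr0n // mul1r ler_nat.
have step (x y : K) n : (n <= 98)%N -> `|x - 1| <= n%:R / 100 -> `|y - 1| <= 1 / 100 ->
    `|x * y - 1| <= (n.+2)%:R / 100.
  move=> n98 xn y1; apply: le_trans (near1_mul xn y1 (c1 _ _)) _; first lia.
  by rewrite (_ : n.+2%:R / 100 = n%:R / 100 + 2 * (1 / 100)) // -(addn2 n) natrD; field.
(* Each further factor within 1/100 of 1 adds 2/100, and 1 + 2 + 2 + 2 = 7. *)
have p4 (x1 x2 x3 x4 : K) : `|x1 - 1| <= 1 / 100 -> `|x2 - 1| <= 1 / 100 ->
    `|x3 - 1| <= 1 / 100 -> `|x4 - 1| <= 1 / 100 ->
    `|x1 * x2 * x3 * x4 - 1| <= 7 / 100.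
  by move=> ? ? ? ?; do 3!apply: (step _ _ _) => //.
pose F := u * u * u * u + u * u * u * v + u * u * v * v + u * v * v * v
          + v * v * v * v - 1.
have -> : u ^+ 5 - u + z = (u - v) * F.
  by rewrite -[LHS]subr0 -vz /F; ring.
rewrite normrM ler_peMr //.
(* Five monomials, each within 7/100 of 1, keep [F] within 3 of 4, hence of norm at least 1. *)
have F4 : `|4 - F| <= 3.
  have -> : 4 - F = - ((u * u * u * u - 1) + (u * u * u * v - 1)
    + (u * u * v * v - 1) + (u * v * v * v - 1) + (v * v * v * v - 1)).
    by rewrite /F; ring.
  rewrite normrN; apply: (@le_trans _ _ (7 / 100 + 7 / 100 + 7 / 100 + 7 / 100 + 7 / 100)).
    do 4!(apply: le_trans (ler_normD _ _) (lerD _ (p4 _ _ _ _ _ _ _ _)) => //).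
    exact: p4.
  rewrite -!mulrDl -!natrD ler_pdivrMr ?ltr0n // -natrM ler_nat //.
have := le_trans (lerB_dist 4 F) F4.
by rewrite normr_nat lerBlDr -lerBlDl -natrB.
Qed.

End TrinomialSeries.

Arguments tri_coef : simpl never.

(** * Averaging over the fourth roots of unity *)

Section FourthRootsAverage.
Context {K : numFieldType}.
Implicit Types (i z : K).

Lemma tri_poly_average i z n : i ^+ 2 = -1 ->
  (tri_poly (4 * n)).[z] + (tri_poly (4 * n)).[i * z]
  + (tri_poly (4 * n)).[- z] + (tri_poly (4 * n)).[- (i * z)]
  = 4 * \sum_(m < n) tri_coef (4 * m) * z ^+ (4 * m).
Proof.
move=> i2; rewrite /tri_poly !horner_poly.
elim: n => [|n IHn]; first by rewrite muln0 !big_ord0 !addr0 mulr0.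
rewrite mulnS addnC addn4 !big_ord_recr [in RHS]/= mulrDr -IHn /=.
set S0 := \sum_(_ < _) _ * z ^+ _; set S1 := \sum_(_ < _) _ * (i * z) ^+ _.
set S2 := \sum_(_ < _) _ * (- z) ^+ _; set S3 := \sum_(_ < _) _ * (- (i * z)) ^+ _.
have pow4 y : y ^+ 4 = z ^+ 4 -> y ^+ (4 * n) = z ^+ (4 * n) by rewrite !exprM => ->.
have i4 : i ^+ 4 = 1 by rewrite (exprM i 2 2) i2 sqrrN expr1n.
have p1 : (i * z) ^+ (4 * n) = z ^+ (4 * n) by apply: pow4; rewrite exprMn i4 mul1r.
have p2 : (- z) ^+ (4 * n) = z ^+ (4 * n) by apply: pow4; ring.
have p3 : (- (i * z)) ^+ (4 * n) = z ^+ (4 * n).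
  by apply: pow4; rewrite -mulN1r !exprMn i4 mul1r; ring.
rewrite !exprS p1 p2 p3.
move: (tri_coef (4 * n)) (tri_coef (4 * n).+1) (tri_coef (4 * n).+2) (tri_coef (4 * n).+3).
move: (z ^+ (4 * n)) => w c0 c1 c2 c3.
(* In the block of exponents 4n to 4n + 3, the odd ones cancel and 4n + 2 leaves a multiple of i^2 +
   1. Replacing 0 by this multiple makes the goal a polynomial identity for [ring]. *)
apply/eqP; rewrite -subr_eq0 -(_ : 2 * c2 * w * z ^+ 2 * (i ^+ 2 + 1) = 0).
  by apply/eqP; ring.
by rewrite i2 addNr mulr0.
Qed.

End FourthRootsAverage.

(** * The coefficients of index 4m as terms of the 4F3 *)

Section HypergeometricCoefficients.
Context {R : realType}.
Local Notation C := R[i].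

Lemma risingS (c : C) k : rising c k.+1 = rising c k * (c + k%:R).
Proof. by rewrite /rising big_ord_recr. Qed.

Lemma rising_gt0 (c : C) k : 0 < c -> 0 < rising c k.
Proof. by move=> c0; apply: prodr_gt0 => j _; rewrite ltr_wpDr. Qed.

(** For k = 4m the shift 5k/4 = 5m is an integer, so the Rothe product runs over the factors of
    index m + 1 to 5m - 1 of the rising factorial of -1/4. Its factor of index 0 is the prefactor
    -1/4, and those of index 1 to m form the rising factorial of 3/4. *)
Lemma tri_coef_rising m :
  tri_coef (4 * m) * rising (3 / 4) m * (4 * m)`!%:R = rising (- (1 / 4)) (5 * m) :> C.
Proof.
case: m => [|m]; first by rewrite /rising !big_ord0 !mul1r.
have f0 : (4 * m.+1)`!%:R != 0 :> C by rewrite pnatr_eq0 -lt0n fact_gt0.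
have -> : rising (3 / 4 : C) m.+1 = \prod_(1 <= j < m.+2) (- (1 / 4) + j%:R).
  rewrite big_add1 big_mkord; apply: eq_bigr => j _; by rewrite -natr1; field.
have -> : rising (- (1 / 4)) (5 * m.+1) = \prod_(0 <= j < 5 * m.+1) (- (1 / 4) + j%:R) :> C.
  by rewrite big_mkord.
rewrite [in RHS](@big_cat_nat _ _ _ m.+2) //=; last by lia.
rewrite [in RHS]big_ltn //= addr0 /tri_coef rotheE //.
rewrite [\prod_(m.+2 <= _ < _) _](_ : _ =
   \prod_(1 <= j < 4 * m.+1) (- (1 / 4) + 5 / 4 * (4 * m.+1)%:R - j%:R)).
  by move: f0; set f := (_`!)%:R => f0; field.
rewrite -{1}[m.+2]add1n big_addn; have -> : (5 * m.+1 - m.+1 = 4 * m.+1)%N by lia.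
rewrite big_nat_rev; apply: eq_big_nat => j /andP[j1 j4].
have -> : (1 + 4 * m.+1 - j.+1 + m.+1 = 5 * m.+1 - j)%N by lia.
rewrite natrB; last by lia.
by rewrite !natrM; field.
Qed.

(** Multiplication formula: the parameters are (-1/4 + j)/5 for j = 0..4, and 3125 = 5^5. The fifth
    one, 3/4, cancels the extra factor of [tri_coef_rising], leaving the four upper parameters. *)
Lemma rising_quintuple m :
  rising (- (1 / 4)) (5 * m) = 3125 ^+ m * rising (- (1 / 20)) m * rising (3 / 20) m
    * rising (7 / 20) m * rising (11 / 20) m * rising (3 / 4) m :> C.
Proof.
elim: m => [|m IHm]; first by rewrite muln0 /rising !big_ord0 !mulr1.
rewrite (_ : 5 * m.+1 = (5 * m).+4.+1)%N; last by lia.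
rewrite !risingS IHm exprS.
move: (rising _ m) (rising _ m) (rising _ m) (rising _ m) (rising _ m) (3125 ^+ m).
by move=> *; field.
Qed.

Lemma fact_quadruple m :
  (4 * m)`!%:R = 256 ^+ m * rising (1 / 4) m * rising (1 / 2) m
    * rising (3 / 4) m * m`!%:R :> C.
Proof.
elim: m => [|m IHm]; first by rewrite muln0 /rising !big_ord0 !mulr1.
rewrite (_ : 4 * m.+1 = (4 * m).+4)%N; last by lia.
rewrite !factS !natrM IHm !risingS exprS.
move: (rising _ m) (rising _ m) (rising _ m) (256 ^+ m) m`!%:R.
by move=> *; field.
Qed.

(** The power of 3125/256 produced by the two multiplication formulas is absorbed by z^4. *)
Lemma hyp43_termE (z zeta : C) m : z ^+ 4 = 256 / 3125 * zeta ->
  hyp43_term (- (1 / 20)) (3 / 20) (7 / 20) (11 / 20) (1 / 4) (1 / 2) (3 / 4) zeta m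
  = tri_coef (4 * m) * z ^+ (4 * m).
Proof.
move=> z4; rewrite /hyp43_term exprM z4 !exprMn exprVn.
have p0 (a b : nat) : 0 < a.+1%:R / b.+1%:R :> C by rewrite divr_gt0 ?ltr0n.
have r1 : rising (1 / 4 : C) m != 0 by rewrite gt_eqF ?rising_gt0 ?(p0 0 3)%N.
have r2 : rising (1 / 2 : C) m != 0 by rewrite gt_eqF ?rising_gt0 ?(p0 0 1)%N.
have r3 : rising (3 / 4 : C) m != 0 by rewrite gt_eqF ?rising_gt0 ?(p0 2 3)%N.
have f0 : m`!%:R != 0 :> C by rewrite pnatr_eq0 -lt0n fact_gt0.
have q0 : 3125 ^+ m != 0 :> C by rewrite expf_eq0 pnatr_eq0 andbF.
have s0 : 256 ^+ m != 0 :> C by rewrite expf_eq0 pnatr_eq0 andbF.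
have := tri_coef_rising m; rewrite rising_quintuple fact_quadruple => h.
have -> : tri_coef (4 * m) = 3125 ^+ m * rising (- (1 / 20)) m * rising (3 / 20) m
    * rising (7 / 20) m * rising (11 / 20) m
    / (256 ^+ m * rising (1 / 4) m * rising (1 / 2) m * rising (3 / 4) m * m`!%:R) :> C.
  apply: (mulIf r3); rewrite [RHS]mulrAC -h.
  move: (tri_coef _) (rising _ m) (rising _ m) (rising _ m) (256 ^+ m) (m`!%:R) r1 r2 r3 f0 s0.
  by move=> c A B D F G *; field; do ?[apply/andP; split].
move: (rising _ m) (rising _ m) (rising _ m) (rising _ m) (rising _ m) (rising _ m) (rising _ m)
  (3125 ^+ m) (256 ^+ m) (m`!%:R) r1 r2 r3 f0 s0 q0.
by move=> *; field; do ?[apply/andP; split].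
Qed.

End HypergeometricCoefficients.

(** * The solution of the quintic by radicals *)

Section ExplicitRoot.
Context {K : numFieldType}.
Variables x m theta : K.
Hypothesis m0 : m != 0.
Hypothesis thetaE : x = 5 * m ^+ 2 * theta ^+ 4.
Hypothesis mE : 2 * m = m ^+ 2 + 5 / 4 * x * (1 + x) ^+ 2.

Definition root_shape (eta : K) : K :=
  1 - eta - 5 / 2 * (1 + x) * eta ^+ 2 - 5 * m * eta ^+ 3.

(** This is u^5 - u + z = 0 for u = b [root_shape eta] and z = 4bN eta/(5E), multiplied by 4E/b,
    where b^4 = m^2/(4E). It holds at all four [eta] because [x] depends on eta^4 only. *)
Lemma root_shape_eq eta : eta ^+ 4 = theta ^+ 4 ->
  m ^+ 2 * root_shape eta ^+ 5
  - 4 * ((1 - x) * (1 + 10 * x + 5 * x ^+ 2)) * root_shape eta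
  + 16 / 5 * ((1 - 5 * x) * (5 + 6 * x + 5 * x ^+ 2)) * eta = 0.
Proof.
move=> eta4; have xE : x = 5 * m ^+ 2 * eta ^+ 4 by rewrite eta4.
apply: (mulfI m0); rewrite mulr0.
(* [q] is a cofactor: after x = 5 m^2 eta^4, [m] times the left-hand side equals [q] times the
   difference of the two sides of [mE], as polynomials in [m] and [eta]. *)
pose q : K := - (2 + 20 * x)
  + (10 - 20 * x) * eta + (5 + 55 * x + 50 * x ^+ 2) * eta ^+ 2
  + 125 / 4 * x * (1 + x) ^+ 2 * eta ^+ 3
  - m + 5 * m * eta + (5 / 2 - 75 / 2 * x) * m * eta ^+ 2 + (10 + 100 * x) * m * eta ^+ 3
  + (- (25 / 4) + 175 / 2 * x + 375 / 4 * x ^+ 2) * m * eta ^+ 4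
  + 125 / 4 * (1 + x) ^+ 2 * m * eta ^+ 5
  + 125 / 8 * (1 + x) ^+ 3 * m * eta ^+ 6 + 25 * m ^+ 2 * eta ^+ 3.
rewrite -(_ : q * (2 * m - (m ^+ 2 + 5 / 4 * x * (1 + x) ^+ 2)) = 0).
  by rewrite /q /root_shape xE; field.
by rewrite mE subrr mulr0.
Qed.

End ExplicitRoot.

(** * Partial sums of the 4F3 compared with the mean of the explicit roots *)

Section PartialSums.
Context {R : realType}.
Local Notation C := R[i].

(** The partial sum is the mean of the truncated series at i^k z. By stability of the root near 1,
    each value is as close to the explicit root at i^k theta as its residue is small, and those four
    roots have mean [b]. *)
Lemma hyp43_partial_sum_bound (x m theta b : C) n :
  let E := (1 - x) * (1 + 10 * x + 5 * x ^+ 2) in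
  let N := (1 - 5 * x) * (5 + 6 * x + 5 * x ^+ 2) in
  E != 0 -> m != 0 -> x = 5 * m ^+ 2 * theta ^+ 4 ->
  2 * m = m ^+ 2 + 5 / 4 * x * (1 + x) ^+ 2 -> b ^+ 4 = m ^+ 2 / (4 * E) ->
  `|b * (4 * N / (5 * E)) * theta| <= 1 / 800 ->
  (forall eta, eta ^+ 4 = theta ^+ 4 -> `|b * root_shape x m eta - 1| <= 1 / 100) ->
  (0 < n)%N ->
  `|series (hyp43_term (- (1 / 20)) (3 / 20) (7 / 20) (11 / 20)
            (1 / 4) (1 / 2) (3 / 4) (zeta14 x)) n - b| <= 2 * (1 / 2) ^+ (4 * n).
Proof.
move=> E N E0 m0 xE mE bE; set z := b * _ * theta => z800 V1 n0.
pose i : C := 'i%C; have i2 : i ^+ 2 = -1 by exact: sqr_i.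
have zetaE : zeta14 x = 1 / 4 * (x * N ^+ 4 / E ^+ 5).
  by rewrite /zeta14 /zeta14_den -!exprMn -(mulrA x) -exprMn.
have rootE eta : eta ^+ 4 = theta ^+ 4 -> m ^+ 2 * root_shape x m eta ^+ 5
    - 4 * E * root_shape x m eta + 16 / 5 * N * eta = 0.
  exact: root_shape_eq.
clearbody E N.
have z4 : z ^+ 4 = 256 / 3125 * zeta14 x.
  rewrite zetaE [in RHS]xE /z !exprMn bE.
  by move: (theta ^+ 4) => w; field; rewrite ?m0 ?E0.
have -> : series (hyp43_term (- (1 / 20)) (3 / 20) (7 / 20) (11 / 20)
            (1 / 4) (1 / 2) (3 / 4) (zeta14 x)) n
    = \sum_(k < n) tri_coef (4 * k) * z ^+ (4 * k).
  by rewrite /series /= big_mkord; apply: eq_bigr => k _; exact: hyp43_termE.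
have near_root (y eta : C) : eta ^+ 4 = theta ^+ 4 -> y = b * (4 * N / (5 * E)) * eta ->
    `|(tri_poly (4 * n)).[y] - b * root_shape x m eta| <= 2 * (1 / 2) ^+ (4 * n).
  move=> eta4 yE.
  (* The four arguments share their fourth power, hence their modulus, so one bound on |z| serves
     all. *)
  have ny : `|y| = `|z|.
    have y4 : y ^+ 4 = z ^+ 4 by rewrite yE /z !exprMn eta4.
    apply/eqP; rewrite -(@eqrXn2 _ 4) //.
    by rewrite -!normrX y4.
  have y800 : `|y| <= 1 / 800 by rewrite ny.
  have le800 (a c : nat) : (a * c.+1 <= 800)%N -> a%:R * `|y| <= 1 / c.+1%:R.
    move=> ac; apply: (@le_trans _ _ (a%:R * (1 / 800))); first by rewrite ler_wpM2l.
    rewrite mulrA mulr1 ler_pdivrMr ?ltr0n // mulrAC mul1r ler_pdivlMr ?ltr0n //.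
    by rewrite -natrM ler_nat.
  apply: le_trans (quintic_root_stable _ (V1 _ eta4) _) (tri_poly_residue _ _).
  (* The constant 1/800 is chosen so that 8|y| <= 1/100, the radius in [quintic_root_stable]. *)
  - apply: le_trans (tri_poly_near1 _ _) (le800 8%N 99%N _) => //; first by rewrite muln_gt0.
    by apply: le_trans (le800 8%N 0%N _) _ => //; rewrite divr1.
  (* The quintic at the explicit root is b/(4E) times [rootE]. *)
  - rewrite -[RHS](mulr0 (b / (4 * E))) -(rootE _ eta4) yE exprMn (exprS b 4) bE.
    by field.
  - by lia.
  - by rewrite (le_trans _ (le800 1%N 63%N isT)) // mulr1n mul1r.
have theta4 eta : eta = theta \/ eta = i * theta \/ eta = - theta \/ eta = - (i * theta) ->
    eta ^+ 4 = theta ^+ 4.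
  have i4 : i ^+ 4 = 1 by rewrite (exprM i 2 2) i2 sqrrN expr1n.
  case=> [->|[->|[->|->]]] //; first by rewrite exprMn i4 mul1r.
    by ring.
  by rewrite -mulN1r !exprMn i4 mul1r; ring.
have avg : root_shape x m theta + root_shape x m (i * theta)
    + root_shape x m (- theta) + root_shape x m (- (i * theta)) = 4.
  apply/eqP; rewrite -subr_eq0 -(_ : - 5 * (1 + x) * theta ^+ 2 * (i ^+ 2 + 1) = 0).
    by apply/eqP; rewrite /root_shape; field.
  by rewrite i2 addNr mulr0.
have := tri_poly_average z n i2; set S := \sum_(_ < _) _ => S4.
have -> : S - b = 1 / 4 * (((tri_poly (4 * n)).[z] - b * root_shape x m theta)
   + ((tri_poly (4 * n)).[i * z] - b * root_shape x m (i * theta))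
   + ((tri_poly (4 * n)).[- z] - b * root_shape x m (- theta))
   + ((tri_poly (4 * n)).[- (i * z)] - b * root_shape x m (- (i * theta)))).
  rewrite (_ : S - b = 1 / 4 * (4 * S - b * (root_shape x m theta
    + root_shape x m (i * theta) + root_shape x m (- theta)
    + root_shape x m (- (i * theta))))); last by rewrite avg; field.
  by rewrite -S4; ring.
rewrite normrM ger0_norm ?mulr_ge0 ?invr_ge0 ?ler0n //.
rewrite mulrC mulrA mulr1 ler_pdivrMr ?ltr0n //.
have -> : 2 * (1 / 2) ^+ (4 * n) * 4 = 2 * (1 / 2) ^+ (4 * n) + 2 * (1 / 2) ^+ (4 * n)
  + 2 * (1 / 2) ^+ (4 * n) + 2 * (1 / 2) ^+ (4 * n) :> C by ring.
do 3!(apply: le_trans (ler_normD _ _) (lerD _ (near_root _ _ _ _));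
  [|by apply: theta4; tauto|by rewrite /z; ring]).
exact: near_root.
Qed.

End PartialSums.

(** * Principal powers and limits in R[i] *)

Section PrincipalPowers.
Context {R : realType}.
Local Notation C := R[i].
Local Notation normc := (@ComplexField.Normc.normc R).

(** Radii of balls in R[i] are themselves complex; a positive one has zero imaginary part, so a
    radius in R can be used. *)
Lemma near_normcP (x : C) (P : C -> Prop) : (\forall y \near x, P y) <->
  exists e : R, 0 < e /\ forall y, normc (y - x) < e -> P y.
Proof.
split.
  move/nbhs_normP => [[e f] /= e0 h]; move: e0; rewrite ltcE /= => /andP[/eqP f0 e0].
  exists e; split => // y yx; apply: h; rewrite /ball_ /= distrC.
  by rewrite ltcE /= f0 eqxx.
move=> [e [e0 h]]; apply/nbhs_normP; exists e%:C; first by rewrite /= ltcR.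
by move=> y /=; rewrite distrC => yx; apply: h; rewrite -ltcR.
Qed.

Lemma normc_ge_Re (z : C) : `|complex.Re z| <= normc z.
Proof. by rewrite -lecR; exact: normc_ge_Re. Qed.

Lemma normc_ge_Im (z : C) : `|complex.Im z| <= normc z.
Proof.
case: z => a b /=; rewrite -[leLHS]ger0_norm // -sqrtr_sqr ler_sqrt ?addr_ge0 ?sqr_ge0 //.
by rewrite real_normK ?num_real // lerDr sqr_ge0.
Qed.

Lemma normc_le_ReIm (z : C) : normc z <= `|complex.Re z| + `|complex.Im z|.
Proof.
case: z => a b /=.
rewrite -(@ler_pXn2r _ 2) ?nnegrE ?sqrtr_ge0 ?addr_ge0 // sqr_sqrtr ?addr_ge0 ?sqr_ge0 //.
rewrite sqrrD !real_normK ?num_real //.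
by rewrite -addrA [_ *+ 2 + _]addrC addrA lerDl mulrn_wge0 // mulr_ge0.
Qed.

Lemma cvg_complexP {T : Type} (F : set_system T) {FF : Filter F} (f : T -> C) (l : C) :
  complex.Re (f t) @[t --> F] --> complex.Re l ->
  complex.Im (f t) @[t --> F] --> complex.Im l -> f t @[t --> F] --> l.
Proof.
move=> /cvgrPdist_lt fre /cvgrPdist_lt fim; apply/cvgrPdist_lt => -[e e'].
rewrite ltcE /= => /andP[/eqP -> e0]; have e2 : 0 < e / 2 by rewrite divr_gt0.
near=> t; rewrite -[_ +i* _]/(e%:C) ltcR.
apply: le_lt_trans (normc_le_ReIm _) _.
have -> : e = e / 2 + e / 2 by rewrite -splitr.
rewrite !raddfB /=; apply: ltrD; near: t; [exact: fre | exact: fim].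
Unshelve. all: by end_near. Qed.

Lemma continuous_normc_lipschitz (g : C -> R) :
  (forall y z, `|g y - g z| <= normc (y - z)) -> continuous g.
Proof.
move=> gl z U /nbhs_ballP[e /= e0 eU]; apply/near_normcP; exists e; split => // y yz.
by apply: eU; rewrite /ball /= distrC; apply: le_lt_trans yz.
Qed.

Lemma continuous_Re : continuous (@complex.Re R : C -> R).
Proof.
by apply: continuous_normc_lipschitz => y z; rewrite -raddfB; exact: normc_ge_Re.
Qed.

Lemma normc_opp (z : C) : normc (- z) = normc z.
Proof. by case: z => a b; rewrite /= !sqrrN. Qed.

Lemma continuous_normc : continuous (normc : C -> R).
Proof.
have h (u v : C) : normc u - normc v <= normc (u - v).
  by rewrite lerBlDr -{1}(subrK v u); exact: le_normcD.
apply: continuous_normc_lipschitz => y z; rewrite ler_norml h andbT.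
by rewrite -[leRHS]opprB lerN2 -[in leRHS](opprB z y) normc_opp h.
Qed.

Lemma normc_gt0 (z : C) : (0 < normc z) = (z != 0).
Proof. by rewrite -(@normr_gt0 _ C) -ltcR.
Qed.

Lemma cos_arg_bound (z : C) : -1 <= complex.Re z / normc z <= 1.
Proof.
have [->|z0] := eqVneq z 0; first by rewrite mul0r lerN10 ler01.
have n0 : 0 < normc z by rewrite normc_gt0.
rewrite ler_pdivlMr // ler_pdivrMr // mulN1r mul1r -ler_norml; exact: normc_ge_Re.
Qed.

Lemma normc_carg (z : C) : z != 0 ->
  z = (normc z)%:C * (cos (carg z) +i* sin (carg z)).
Proof.
move=> z0; have n0 : 0 < normc z by rewrite normc_gt0.
have cb := cos_arg_bound z.
have cE : cos (carg z) = complex.Re z / normc z.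
  by rewrite /carg; case: ifP => _; rewrite ?cosN acosK.
have sE : normc z * sin (acos (complex.Re z / normc z)) = `|complex.Im z|.
  have -> : sin (acos (complex.Re z / normc z)) = Num.sqrt (1 - (complex.Re z / normc z) ^+ 2).
    exact: sin_acos.
  rewrite -sqrtr_sqr -{1}(ger0_norm (ltW n0)) -sqrtr_sqr -sqrtrM ?sqr_ge0 //.
  rewrite mulrBr mulr1 -exprMn [normc z * _]mulrC divfK ?gt_eqF //; congr (Num.sqrt _).
  by case: z {z0 n0 cb cE} => a b /=; rewrite sqr_sqrtr ?addr_ge0 ?sqr_ge0 // addrC addKr.
have im : normc z * sin (carg z) = complex.Im z.
  rewrite /carg; case: ifP => h; first by rewrite sE ger0_norm.
  by rewrite sinN mulrN sE ltr0_norm ?opprK // ltNge h.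
have re : normc z * cos (carg z) = complex.Re z by rewrite cE mulrC divfK ?gt_eqF.
apply/eqP; rewrite eq_complex /= !mul0r subr0 addr0 im re !eqxx //.
Qed.

Lemma cexp_mulrn (z : C) n : cexp (n%:R * z) = cexp z ^+ n.
Proof.
have cexpD (u v : C) : cexp (u + v) = cexp u * cexp v.
  rewrite /cexp !raddfD /= expRD cosD sinD.
  by apply/eqP; rewrite eq_complex /=; apply/andP; split; apply/eqP; ring.
elim: n => [|n IHn].
  by rewrite mul0r expr0 /cexp /= expR0 cos0 sin0 mul1r.
by rewrite -natr1 mulrDl mul1r cexpD IHn exprSr.
Qed.

Lemma cexp_clog (z : C) : z != 0 -> cexp (clog z) = z.
Proof.
by move=> z0; rewrite /cexp /= lnK ?posrE ?normc_gt0 // -normc_carg.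
Qed.

Lemma cpow_inv_exp (z : C) n : z != 0 -> cpow z (1 / n.+1%:R) ^+ n.+1 = z.
Proof.
move=> z0; rewrite /cpow (negbTE z0) -cexp_mulrn mulrA -[n.+1%:R in LHS](rmorph_nat (real_complex R)).
by rewrite -rmorphM /= mulrCA divff ?pnatr_eq0 // mulr1 mul1r cexp_clog.
Qed.

Section Limits.
Context {T : Type} (F : set_system T) {FF : Filter F}.
Variable f : T -> C.
Hypothesis f1 : f t @[t --> F] --> (1 : C).

Let normc_f1 : normc (f t) @[t --> F] --> (1 : R).
Proof.
rewrite -(@ComplexField.Normc.normc1 R).
exact: (cvg_comp _ _ f1 (@continuous_normc 1)).
Qed.

(** The modulus of the argument is an arccosine, whatever the sign chosen by [carg]. It is small
    once its cosine is close to 1, since cos decreases on [0, pi]. *)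
Lemma carg_cvg0 : carg (f t) @[t --> F] --> (0 : R).
Proof.
have cvg_cos : complex.Re (f t) / normc (f t) @[t --> F] --> (1 : R).
  rewrite -[X in _ --> X](_ : 1 / 1 = 1); last by rewrite divr1.
  apply: cvgM; first exact: (cvg_comp _ _ f1 (@continuous_Re 1)).
  by apply: cvgV => //; exact: oner_neq0.
apply/cvgrPdist_lt => e e0.
pose d := Num.min e pi; have d0 : 0 < d by rewrite lt_min e0 pi_gt0.
have dpi : d <= pi by rewrite ge_min lexx orbT.
have cd : cos d < 1.
  by rewrite -cos0 ltr_cos // ?in_itv /= ?lexx ?pi_ge0 // (ltW d0).
have near_cos := cvgr_gt _ cvg_cos _ cd.
near=> z; rewrite sub0r normrN.
have -> : `|carg (f z)| = acos (complex.Re (f z) / normc (f z)).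
  by rewrite /carg; case: ifP => _; rewrite ?normrN ger0_norm // acos_ge0 // cos_arg_bound.
apply: (@lt_le_trans _ _ d); last by rewrite ge_min lexx.
rewrite -ltr_cos ?in_itv /= ?acos_ge0 ?acos_lepi ?cos_arg_bound // ?(ltW d0) //.
rewrite acosK ?in_itv /= ?cos_arg_bound //; near: z; exact: near_cos.
Unshelve. all: by end_near. Qed.

Lemma cpow_cvg1 (a : R) : cpow (f t) a @[t --> F] --> (1 : C).
Proof.
have arg0 : a * carg (f t) @[t --> F] --> (0 : R).
  rewrite -[X in _ --> X](mulr0 a); apply: cvgM carg_cvg0; exact: cvg_cst.
have exp1 : expR (a * ln (normc (f t))) @[t --> F] --> (1 : R).
  rewrite -(expR0 R); apply: continuous_cvg; first exact: continuous_expR.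
  rewrite -[X in _ --> X](mulr0 a); apply: cvgM; first exact: cvg_cst.
  rewrite -ln1; apply: continuous_cvg => //.
  exact: continuous_ln.
have cpowE : \forall t \near F, (expR (a * ln (normc (f t))) * cos (a * carg (f t)))
    +i* (expR (a * ln (normc (f t))) * sin (a * carg (f t))) = cpow (f t) a.
  have n0 := cvgr_gt _ normc_f1 _ ltr01.
  near=> t; have /negbTE ft0 : f t != 0 by rewrite -normc_gt0; near: t; exact: n0.
  rewrite /cpow ft0 /cexp /=; apply/eqP; rewrite eq_complex /=.
  by rewrite !mul0r !subr0 !addr0 !eqxx.
apply: cvg_trans (near_eq_cvg cpowE) _; apply: cvg_complexP => /=.
  rewrite -[X in _ --> X](mulr1 1) -[X in _ * X]cos0; apply: cvgM => //.
  by apply: continuous_cvg => //; exact: continuous_cos.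
rewrite -[X in _ --> X](mul1r 0) -[X in _ * X]sin0; apply: cvgM => //.
by apply: continuous_cvg => //; exact: continuous_sin.
Unshelve. all: by end_near. Qed.

End Limits.

Section ComplexLimits.
Context {T : Type} (F : set_system T) {FF : Filter F}.
Implicit Types (g h : T -> C) (a b c : C).

(* The functions are written as lambdas, and used with explicit proof terms,
   because unifying up to [g \* h] over R[i], or comparing two such limits up to
   conversion as [done] does, is prohibitively slow. *)
Lemma ccvg_mul g h a b : g t @[t --> F] --> a -> h t @[t --> F] --> b ->
  g t * h t @[t --> F] --> a * b.
Proof. by move=> ga hb; exact: (cvgM ga hb). Qed.

Lemma ccvg_add g h a b : g t @[t --> F] --> a -> h t @[t --> F] --> b ->
  g t + h t @[t --> F] --> a + b.
Proof. by move=> ga hb; exact: (cvgD ga hb). Qed.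

Lemma ccvg_sub g h a b : g t @[t --> F] --> a -> h t @[t --> F] --> b ->
  g t - h t @[t --> F] --> a - b.
Proof. by move=> ga hb; exact: (cvgB ga hb). Qed.

Lemma ccvg_inv g a : a != 0 -> g t @[t --> F] --> a ->
  (g t)^-1 @[t --> F] --> a^-1.
Proof. by move=> a0 ga; exact: (cvgV a0 ga). Qed.

Lemma ccvg_const (c : C) : (fun=> c) @ F --> c.
Proof. exact: cvg_cst. Qed.

Lemma ccvg_horner (p : {poly C}) g a : g t @[t --> F] --> a ->
  p.[g t] @[t --> F] --> p.[a].
Proof.
move=> ga; elim/poly_ind: p => [|p c IHp].
  rewrite horner0 (_ : (fun t => 0.[g t]) = (fun=> 0)); first exact (@ccvg_const 0).
  by apply/funext => t; rewrite horner0.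
rewrite hornerMXaddC.
rewrite (_ : (fun t => _.[g t]) = (fun t => p.[g t] * g t + c)).
  exact (ccvg_add (ccvg_mul IHp ga) (@ccvg_const c)).
by apply/funext => t; rewrite hornerMXaddC.
Qed.

End ComplexLimits.

End PrincipalPowers.

(** * Convergence and the closed form near x = 0 *)

Section NearZero.
Context {R : realType}.
Local Notation C := R[i].

Lemma cvg_of_geometric_bound (u : nat -> C) (l : C) :
  (forall n, (0 < n)%N -> `|u n - l| <= 2 * (1 / 2) ^+ (4 * n)) -> u @ \oo --> l.
Proof.
move=> ul; apply/cvgrPdist_lt => -[e e']; rewrite ltcE /= => /andP[/eqP -> e0].
have half1 : `|1 / 2 : R| < 1.
  by rewrite ger0_norm ?divr_ge0 // ltr_pdivrMr // mul1r ltr1n.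
have /cvgrPdist_lt/(_ (e / 2)) h := cvg_expr half1.
have e2 : 0 < e / 2 by rewrite divr_gt0.
near=> n; rewrite -[_ +i* _]/(e%:C) distrC; apply: le_lt_trans (ul n _) _.
  by near: n; exact: nbhs_infty_gt.
have n4 : (1 / 2) ^+ (4 * n) <= (1 / 2) ^+ n :> C.
  apply: ler_wiXn2l; rewrite ?divr_ge0 ?ler_pdivrMr ?ltr0n ?mul1r ?ler1n ?ler0n //.
  by rewrite leq_pmull.
apply: (@le_lt_trans _ _ (2 * (1 / 2) ^+ n)); first by rewrite ler_wpM2l ?ler0n.
have -> : 2 * (1 / 2) ^+ n = (2 * (1 / 2) ^+ n)%:C :> C.
  by rewrite rmorphM rmorphXn rmorphM fmorphV !rmorph_nat rmorph1.
rewrite ltcR mulrC -ltr_pdivlMr // -[X in X < _]ger0_norm ?exprn_ge0 ?divr_ge0 //.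
by rewrite -normrN -[X in `|X|]add0r; near: n; exact: h.
Unshelve. all: by end_near. Qed.

(** The non-constant part of the root shape is at most (1 + 5 + 15) e = 21e with e = 10^-4, and
    1/200 + 2 * 21e <= 1/100. *)
Lemma root_shape_near1 (x m b eta e : C) :
  `|x| <= 1 -> `|m| <= 3 -> `|b - 1| <= 1 / 200 -> e = 1 / 100 / 100 ->
  `|eta| <= e -> `|b * root_shape x m eta - 1| <= 1 / 100.
Proof.
move=> x1 m3 b1 eE ee.
have e0 : 0 <= e by exact: le_trans ee.
have e1 : e <= 1.
  by rewrite eE !ler_pdivrMr ?ltr0n // !mul1r -natrM ler1n.
have b2 : `|b| <= 2.
  rewrite -[b](subrK 1); apply: le_trans (ler_normD _ _) _.
  rewrite normr1 -[leRHS]/(1 + 1) lerD2r; apply: le_trans b1 _.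
  by rewrite ler_pdivrMr ?ltr0n // mul1r ler1n.
have eta1 : `|eta| <= 1 by exact: le_trans ee e1.
pose r := eta * (1 + 5 / 2 * (1 + x) * eta + 5 * m * eta ^+ 2).
have -> : b * root_shape x m eta - 1 = (b - 1) - b * r by rewrite /root_shape /r; ring.
have r21 : `|r| <= e * 21.
  rewrite /r normrM; apply: ler_pM => //.
  have -> : 21 = 1 + 5 + 15 :> C by ring.
  apply: le_trans (ler_normD _ _) (lerD _ _).
    apply: le_trans (ler_normD _ _) (lerD _ _); first by rewrite normr1.
    rewrite !normrM normfV !normr_nat.
    rewrite [leRHS](_ : 5 = 5 / 2 * 2 * 1 :> C); last by field.
    rewrite ler_pM ?mulr_ge0 ?invr_ge0 ?ler0n // ler_wpM2l ?mulr_ge0 ?invr_ge0 ?ler0n //.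
    by apply: le_trans (ler_normD _ _) _; rewrite normr1 -[leRHS]/(1 + 1) lerD2l.
  rewrite !normrM normr_nat.
  rewrite [leRHS](_ : 15 = 5 * 3 * (1 * 1) :> C); last by ring.
  by rewrite ler_pM ?mulr_ge0 ?ler0n // ?ler_wpM2l ?ler0n // ler_pM.
apply: le_trans (ler_normB _ _) _.
apply: (@le_trans _ _ (1 / 200 + 2 * (e * 21))).
  by apply: lerD => //; rewrite normrM ler_pM.
rewrite eE -subr_ge0.
have -> : 1 / 100 - (1 / 200 + 2 * (1 / 100 / 100 * 21)) = 2 / 25 / 100 :> C by field.
by rewrite !divr_ge0 ?ler0n.
Qed.

Context {T : Type} (F : set_system T) {FF : Filter F}.
Variable f : T -> C.
Hypothesis f0 : f t @[t --> F] --> (0 : C).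

Let cvgX n : f t ^+ n @[t --> F] --> (0 ^+ n : C).
Proof.
have h := ccvg_horner (FF := FF) (p := 'X^n) f0; rewrite hornerXn in h.
rewrite (_ : (fun t => f t ^+ n) = (fun t => 'X^n.[f t])); first exact h.
by apply/funext => t; rewrite hornerXn.
Qed.

Let cvg_cubic (a b c d : C) :
  a - b * f t - c * f t ^+ 2 - d * f t ^+ 3 @[t --> F] --> (a : C).
Proof.
rewrite -[X in _ --> X](_ : a - b * 0 - c * 0 ^+ 2 - d * 0 ^+ 3 = a); last by ring.
exact (ccvg_sub (ccvg_sub (ccvg_sub (@ccvg_const _ _ F _ a) (ccvg_mul (@ccvg_const _ _ F _ b) f0))
  (ccvg_mul (@ccvg_const _ _ F _ c) (@cvgX 2))) (ccvg_mul (@ccvg_const _ _ F _ d) (@cvgX 3))).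
Qed.

(** As f tends to 0, [w] and [b] tend to 1 and [s] to 4, so the smallness hypotheses of
    [hyp43_partial_sum_bound] eventually hold. The partial sums then converge to [b], the right-hand
    side divided by the prefactor. *)
Lemma hyp43_near0 : \forall t \near F, let x := f t in
  hyp43_cvg (- (1 / 20)) (3 / 20) (7 / 20) (11 / 20) (1 / 4) (1 / 2) (3 / 4) (zeta14 x) /\
  cpow (1 - x) (1 / 4) * cpow (1 + 10 * x + 5 * x ^+ 2) (1 / 4)
  * hyp43 (- (1 / 20)) (3 / 20) (7 / 20) (11 / 20) (1 / 4) (1 / 2) (3 / 4) (zeta14 x)
  = cpow (1 / 2 - 5 / 16 * x - 5 / 8 * x ^+ 2 - 5 / 16 * x ^+ 3
          + 1 / 2 * cpow (1 - 5 / 4 * x - 5 / 2 * x ^+ 2 - 5 / 4 * x ^+ 3) (1 / 2))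
         (1 / 4).
Proof.
pose P t := 1 - 5 / 4 * f t - 5 / 2 * f t ^+ 2 - 5 / 4 * f t ^+ 3.
have P1 : P t @[t --> F] --> (1 : C) by exact (@cvg_cubic _ _ _ _).
pose w t := cpow (P t) (1 / 2).
have w1 : w t @[t --> F] --> (1 : C) by exact (cpow_cvg1 P1 _).
pose Q t := 1 / 2 - 5 / 16 * f t - 5 / 8 * f t ^+ 2 - 5 / 16 * f t ^+ 3 + 1 / 2 * w t.
have Q1 : Q t @[t --> F] --> (1 : C).
  rewrite -[X in _ --> X](_ : 1 / 2 + 1 / 2 * 1 = 1 :> C); last by field.
  exact (ccvg_add (@cvg_cubic _ _ _ _) (ccvg_mul (@ccvg_const _ _ F _ _) w1)).
pose q t := cpow (Q t) (1 / 4).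
have q1 : q t @[t --> F] --> (1 : C) by exact (cpow_cvg1 Q1 _).
pose E1 t := 1 - f t; pose E2 t := 1 + 10 * f t + 5 * f t ^+ 2.
have E11 : E1 t @[t --> F] --> (1 : C).
  rewrite -[X in _ --> X](subr0 1); exact (ccvg_sub (@ccvg_const _ _ F _ _) f0).
have E21 : E2 t @[t --> F] --> (1 : C).
  rewrite -[X in _ --> X](_ : 1 + 10 * 0 + 5 * 0 ^+ 2 = 1 :> C); last by ring.
  exact (ccvg_add (ccvg_add (@ccvg_const _ _ F _ _) (ccvg_mul (@ccvg_const _ _ F _ _) f0))
    (ccvg_mul (@ccvg_const _ _ F _ _) (@cvgX 2))).
pose a1 t := cpow (E1 t) (1 / 4); pose a2 t := cpow (E2 t) (1 / 4).
have a11 : a1 t @[t --> F] --> (1 : C) by exact (cpow_cvg1 E11 _).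
have a21 : a2 t @[t --> F] --> (1 : C) by exact (cpow_cvg1 E21 _).
pose b t := q t / (a1 t * a2 t).
have b1 : b t @[t --> F] --> (1 : C).
  rewrite -[X in _ --> X](_ : 1 / (1 * 1) = 1 :> C); last by field.
  have n0 : 1 * 1 != 0 :> C by rewrite mulr1 oner_neq0.
  exact (ccvg_mul q1 (ccvg_inv n0 (ccvg_mul a11 a21))).
pose N t := (1 - 5 * f t) * (5 + 6 * f t + 5 * f t ^+ 2).
(* [s] is the ratio z/theta; its limit is 4 N(0)/(5 E(0)) = 4. *)
pose s t := b t * (4 * N t / (5 * (E1 t * E2 t))).
have s4 : s t @[t --> F] --> (4 : C).
  rewrite -[X in _ --> X](_ : 1 * (4 * ((1 - 5 * 0) * (5 + 6 * 0 + 5 * 0 ^+ 2))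
    / (5 * (1 * 1))) = 4 :> C); last by field.
  have n0 : 5 * (1 * 1) != 0 :> C by rewrite !mulr1 pnatr_eq0.
  have N5 : N t @[t --> F] --> ((1 - 5 * 0) * (5 + 6 * 0 + 5 * 0 ^+ 2) : C).
    exact (ccvg_mul (ccvg_sub (@ccvg_const _ _ F _ 1) (ccvg_mul (@ccvg_const _ _ F _ 5) f0))
      (ccvg_add (ccvg_add (@ccvg_const _ _ F _ 5) (ccvg_mul (@ccvg_const _ _ F _ 6) f0))
        (ccvg_mul (@ccvg_const _ _ F _ 5) (@cvgX 2)))).
  exact (ccvg_mul b1 (ccvg_mul (ccvg_mul (@ccvg_const _ _ F _ 4) N5)
    (ccvg_inv n0 (ccvg_mul (@ccvg_const _ _ F _ 5) (ccvg_mul E11 E21))))).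
have c0 n : 0 < 1 / n.+1%:R :> C by rewrite divr_gt0 ?ltr0n.
(* [e] will bound |theta|: it suits [root_shape_near1], and |s| <= 5 gives |z| <= 5e <= 1/800. The
   bound e^4 on |x| suffices because |theta|^4 = |x|/(5|m|^2) <= |x| when |m| >= 1. *)
pose e : C := 1 / 100 / 100.
have e0 : 0 < e by rewrite !divr_gt0 ?ltr0n.
have neq0 (g : T -> C) : g t @[t --> F] --> (1 : C) -> \forall t \near F, g t != 0.
  move=> /cvgrPdist_lt/(_ 1 ltr01); apply: filterS => t.
  by apply: contraTN => /eqP ->; rewrite subr0 normr1 ltxx.
have nP := neq0 _ P1; have nQ := neq0 _ Q1.
have nE1 := neq0 _ E11; have nE2 := neq0 _ E21.
have /cvgrPdist_le/(_ _ ltr01) nw := w1.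
have /cvgrPdist_le/(_ _ (c0 199%N)) nb := b1.
have /cvgrPdist_le/(_ _ ltr01) ns := s4.
have /cvgrPdist_le/(_ (e ^+ 4)) nx := f0.
have {}nx := nx (exprn_gt0 _ e0).
clear P1 w1 Q1 q1 E11 E21 a11 a21 b1 s4 neq0.
near=> t => x.
have w2 : w t ^+ 2 = P t by apply: cpow_inv_exp; near: t.
have q4 : q t ^+ 4 = Q t by apply: cpow_inv_exp; near: t.
have E10 : E1 t != 0 by near: t.
have E20 : E2 t != 0 by near: t.
have a14 : a1 t ^+ 4 = E1 t by apply: cpow_inv_exp.
have a24 : a2 t ^+ 4 = E2 t by apply: cpow_inv_exp.
have a10 : a1 t != 0 by apply: contraNneq E10 => a10; rewrite -a14 a10 expr0n.
have a20 : a2 t != 0 by apply: contraNneq E20 => a20; rewrite -a24 a20 expr0n.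
have w1t : `|1 - w t| <= 1 by near: t.
have b1t : `|1 - b t| <= 1 / 200 by near: t.
have s4t : `|4 - s t| <= 1 by near: t.
have xt : `|0 - f t| <= e ^+ 4 by near: t.
rewrite sub0r normrN -/x in xt; rewrite distrC in b1t.
pose m := 1 + w t.
have m1 : 1 <= `|m|.
  have := le_trans (lerB_dist 2 m) (_ : `|2 - m| <= 1).
  rewrite normr_nat lerBlDr -lerBlDl (_ : 2 - 1 = 1 :> C); last by ring.
  by apply; rewrite /m (_ : 2 - (1 + w t) = 1 - w t) //; ring.
have m3 : `|m| <= 3.
  rewrite (_ : m = 2 - (1 - w t)); last by rewrite /m; ring.
  apply: le_trans (ler_normB _ _) _; rewrite normr_nat.
  by rewrite (_ : 3 = 2 + 1 :> C) ?lerD2l //; ring.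
have m0 : m != 0 by rewrite -normr_gt0 (lt_le_trans ltr01).
have mE : 2 * m = m ^+ 2 + 5 / 4 * x * (1 + x) ^+ 2.
  apply/eqP; rewrite -subr_eq0 -(_ : P t - w t ^+ 2 = 0); last by rewrite w2 subrr.
  by apply/eqP; rewrite /m /P -/x; field.
have QE : Q t = m ^+ 2 / 4.
  apply/eqP; rewrite -subr_eq0 -(_ : 1 / 4 * (P t - w t ^+ 2) = 0).
    by apply/eqP; rewrite /m /Q /P -/x; field.
  by rewrite w2 subrr mulr0.
have bE : b t ^+ 4 = m ^+ 2 / (4 * (E1 t * E2 t)).
  rewrite /b exprMn exprVn exprMn a14 a24 q4 QE.
  by move: E10 E20; move: (E1 t) (E2 t) => u v u0 v0; field; rewrite ?u0 ?v0.
(* Any fourth root will do: the estimates below depend on theta^4 only, so no continuity of the root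
   is required. *)
pose theta := 4.-root (x / (5 * m ^+ 2)).
have theta4 : theta ^+ 4 = x / (5 * m ^+ 2) by exact: rootCK.
have xE : x = 5 * m ^+ 2 * theta ^+ 4 by rewrite theta4; field.
have e1 : e <= 1.
  by rewrite /e !ler_pdivrMr ?ltr0n // !mul1r -natrM ler1n.
have x1 : `|x| <= 1 by apply: le_trans xt _; rewrite exprn_ile1 // ltW.
have eta_small eta : eta ^+ 4 = theta ^+ 4 -> `|eta| <= e.
  rewrite theta4 => eta4; rewrite -(@ler_pXn2r _ 4) ?nnegrE ?(ltW e0) //.
  rewrite -normrX eta4 normrM normfV ler_pdivrMr; last first.
    by rewrite normrM normr_nat mulr_gt0 ?ltr0n // normr_gt0 expf_neq0.
  apply: le_trans xt _; rewrite ler_peMr ?exprn_ge0 ?(ltW e0) //.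
  rewrite normrM normr_nat normrX.
  by rewrite mulr_ege1 ?ler1n ?exprn_ege1.
have z800 : `|s t * theta| <= 1 / 800.
  rewrite normrM; apply: (@le_trans _ _ (5 * e)).
    rewrite ler_pM ?eta_small // -[s t](subKr 4).
    apply: le_trans (ler_normB _ _) _; rewrite normr_nat.
    by rewrite (_ : 5 = 4 + 1 :> C) ?lerD2l //; ring.
  rewrite /e -subr_ge0 (_ : 1 / 800 - 5 * (1 / 100 / 100) = 3 / 40 / 100 :> C).
    by rewrite !divr_ge0 ?ler0n.
  by field.
have Stob : series (hyp43_term (- (1 / 20)) (3 / 20) (7 / 20) (11 / 20)
            (1 / 4) (1 / 2) (3 / 4) (zeta14 x)) n @[n --> \oo] --> (b t : C).
  apply: cvg_of_geometric_bound => n n0.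
  apply: (hyp43_partial_sum_bound _ m0 xE mE bE z800 _ n0); first by rewrite mulf_neq0.
  by move=> eta /eta_small; exact: root_shape_near1.
split; first by apply/cvg_ex; exists (b t).
rewrite /hyp43 (cvg_lim _ Stob); last exact: norm_hausdorff.
rewrite -[RHS]/(q t) -[cpow _ _ * cpow _ _]/(a1 t * a2 t) /b.
by rewrite mulrCA divff ?mulr1 // mulf_neq0.
Unshelve. all: by end_near. Qed.

End NearZero.

(** * Numerator, denominator and Wronskian of the covering *)

Section Zeta14Polynomials.
Context {R : realType}.
Local Notation C := R[i].
Implicit Types x z : C.

Definition znum : {poly C} :=
  'X * (1%:P - 5%:P * 'X) ^+ 4 * (5%:P + 6%:P * 'X + 5%:P * 'X ^+ 2) ^+ 4.

Definition zden : {poly C} :=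
  4%:P * (1%:P - 'X) ^+ 5 * (1%:P + 10%:P * 'X + 5%:P * 'X ^+ 2) ^+ 5.

(* z^15 znum(1/z) and z^15 zden(1/z) *)
Definition rnum : {poly C} :=
  'X ^+ 2 * ('X - 5%:P) ^+ 4 * (5%:P * 'X ^+ 2 + 6%:P * 'X + 5%:P) ^+ 4.

Definition rden : {poly C} :=
  4%:P * ('X - 1%:P) ^+ 5 * ('X ^+ 2 + 10%:P * 'X + 5%:P) ^+ 5.

Definition wronskian (p q : {poly C}) : {poly C} := p^`() * q - p * q^`().

Lemma wronskianC p q : wronskian q p = - wronskian p q.
Proof. by rewrite /wronskian opprB mulrC [q * _]mulrC. Qed.

Let hornerEs := (hornerC, hornerX, horner_exp, hornerMn, hornerN, hornerD, hornerM).

Lemma horner_znum x :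
  znum.[x] = x * (1 - 5 * x) ^+ 4 * (5 + 6 * x + 5 * x ^+ 2) ^+ 4.
Proof. by rewrite /znum !hornerEs. Qed.

Lemma horner_zden x : zden.[x] = 4 * zeta14_den x.
Proof. by rewrite /zden !hornerEs -mulrA. Qed.

Lemma horner_rnum z :
  rnum.[z] = z ^+ 2 * (z - 5) ^+ 4 * (5 * z ^+ 2 + 6 * z + 5) ^+ 4.
Proof. by rewrite /rnum !hornerEs. Qed.

Lemma horner_rden z : rden.[z] = 4 * (z - 1) ^+ 5 * (z ^+ 2 + 10 * z + 5) ^+ 5.
Proof. by rewrite /rden !hornerEs. Qed.

Lemma zden_eq0 x : (zden.[x] == 0) = (zeta14_den x == 0).
Proof. by rewrite horner_zden mulf_eq0 pnatr_eq0. Qed.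

Lemma zeta14E x : zeta14 x = znum.[x] / zden.[x].
Proof.
rewrite /zeta14 horner_znum horner_zden (invfM 4) mul1r.
by move: (zeta14_den x)^-1 => d; ring.
Qed.

Lemma rnumE z : z != 0 -> rnum.[z] = z ^+ 15 * znum.[z^-1].
Proof. by move=> z0; rewrite horner_rnum horner_znum; field. Qed.

Lemma rdenE z : z != 0 -> rden.[z] = z ^+ 15 * zden.[z^-1].
Proof. by move=> z0; rewrite horner_rden horner_zden /zeta14_den; field. Qed.

Lemma zeta14_inv z : zeta14 z^-1 = rnum.[z] / rden.[z].
Proof.
have [->|z0] := eqVneq z 0.
  by rewrite zeta14E invr0 horner_znum horner_rnum expr0n !mul0r.
rewrite zeta14E rnumE // rdenE // invfM mulrACA mulfV ?mul1r //.
by rewrite expf_neq0.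
Qed.

(** The Wronskian of [znum] and [zden] up to the constant 20: a factor of multiplicity e in [znum],
    [zden] or their difference appears with exponent e - 1. *)
Definition zeta14_crit x : C :=
  (1 - 5 * x) ^+ 3 * (5 + 6 * x + 5 * x ^+ 2) ^+ 3
  * ((1 - 55 * x - 5 * x ^+ 2 - 5 * x ^+ 3) * (1 + 5 * x ^+ 2 + 10 * x ^+ 3))
  * ((1 - x) ^+ 4 * (1 + 10 * x + 5 * x ^+ 2) ^+ 4).

Let derivEs := (derivC, derivX, deriv_exp, derivN, derivD, derivM).

Lemma wronskian_zeta14 x : (wronskian znum zden).[x] = 20 * zeta14_crit x.
Proof.
rewrite /wronskian /znum /zden /zeta14_crit.
rewrite !derivEs.
rewrite -[1 in X in X.[_]]polyC1.
rewrite !hornerEs /=.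
ring.
Qed.

(** Reversing two polynomials of formal degree 15 turns their Wronskian W(x) into -z^28 W(1/z),
    where 28 = 2 * 15 - 2. *)
Lemma wronskian_zeta14_inv z : z != 0 ->
  (wronskian rnum rden).[z] = - 20 * z ^+ 28 * zeta14_crit z^-1.
Proof.
move=> z0; rewrite /wronskian /rnum /rden /zeta14_crit.
rewrite !derivEs.
rewrite -[1 in X in X.[_]]polyC1.
rewrite !hornerEs /=.
by field.
Qed.

Lemma zeta14_one_sub x : zeta14_den x != 0 ->
  zeta14 x =
    1 - (4 - 5 * x - 10 * x ^+ 2 - 5 * x ^+ 3)
        * (1 - 55 * x - 5 * x ^+ 2 - 5 * x ^+ 3) ^+ 2
        * (1 + 5 * x ^+ 2 + 10 * x ^+ 3) ^+ 2
        / (4 * (1 - x) ^+ 5 * (1 + 10 * x + 5 * x ^+ 2) ^+ 5).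
Proof.
rewrite /zeta14 /zeta14_den mulf_eq0 !expf_eq0 /= negb_or => /andP[a0 b0].
by field; rewrite a0 b0.
Qed.

Lemma zeta14_s x : x != 0 -> zeta14_den x != 0 ->
  zeta14 x =
    let s := - ((1 - 5 * x) * (5 + 6 * x + 5 * x ^+ 2)) / (64 * x) in
    5 ^+ 5 / 4 ^+ 4 * (s ^+ 4 / (1 - s) ^+ 5).
Proof.
move=> x0; rewrite /zeta14 /zeta14_den mulf_eq0 !expf_eq0 /= negb_or => /andP[a0 b0].
rewrite (_ : 1 - _ / _ = 5 * ((1 - x) * (1 + 10 * x + 5 * x ^+ 2)) / (64 * x)); last by field.
by field; rewrite a0 b0 x0.
Qed.

(** From 5E = 64x + N: at a zero of E one has x != 0 because E(0) = 1, hence N = -64x is nonzero. *)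
Lemma znum_zden_coprime x : zden.[x] = 0 -> znum.[x] != 0.
Proof.
rewrite horner_zden horner_znum /zeta14_den -exprMn => /eqP.
rewrite mulf_eq0 pnatr_eq0 expf_eq0 /= => /eqP E0.
have e64 : 64 * x = - ((1 - 5 * x) * (5 + 6 * x + 5 * x ^+ 2)).
  rewrite -[LHS]subr0 -(mulr0 5) -E0; ring.
have x0 : x != 0.
  by apply: contra_eq_neq E0 => ->; rewrite !(mulr0, expr0n) subr0 !addr0 mulr1 oner_neq0.
rewrite -mulrA -exprMn mulf_neq0 // expf_neq0 // -oppr_eq0 -e64.
by rewrite mulf_neq0 // pnatr_eq0.
Qed.

Lemma zeta14_crit_values x : zeta14_crit x = 0 ->
  [\/ zeta14_den x = 0, zeta14 x = 0 | zeta14_den x != 0 /\ zeta14 x = 1].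
Proof.
have [d0|d0] := eqVneq (zeta14_den x) 0; first by move=> _; exact: Or31.
move=> /eqP; rewrite /zeta14_crit !mulf_eq0 !orbb -!orbA => /or4P[/eqP a|/eqP a|/eqP a|].
- by apply: Or32; rewrite /zeta14 a expr0n /= !(mul0r, mulr0).
- by apply: Or32; rewrite /zeta14 a expr0n /= !(mul0r, mulr0).
- by apply: Or33; split => //; rewrite zeta14_one_sub // a expr0n /= !(mul0r, mulr0) subr0.
- case/or3P => /eqP a.
  + by apply: Or33; split => //; rewrite zeta14_one_sub // a expr0n /= !(mul0r, mulr0) subr0.
  + by move: d0; rewrite /zeta14_den a expr0n mul0r eqxx.
  + by move: d0; rewrite /zeta14_den a expr0n mulr0 eqxx.
Qed.

End Zeta14Polynomials.

(** * The map in charts: derivatives and ramification *)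

Section ProjectiveMap.
Context {R : realType}.
Local Notation C := R[i].
Local Notation normc := (@ComplexField.Normc.normc R).
Implicit Types (p q : {poly C}) (z : C).

(** The polynomial q(z) p - p(z) q vanishes at z, so it is (X - z) r, where r(z) is its derivative
    at z, the Wronskian. The difference quotient is then r(z+h)/(q(z+h) q(z)), a continuous
    expression at h = 0. *)
Lemma quotient_difference_cvg p q z : q.[z] != 0 ->
  (fun h : C => h^-1 *: (((fun y => p.[y] / q.[y]) \o shift z) (h *: 1)
                         - p.[z] / q.[z])) @ (0 : C)^'
  --> (wronskian p q).[z] / q.[z] ^+ 2.
Proof.
move=> qz.
pose P := q.[z] *: p - p.[z] *: q.
have /factor_theorem[r PE] : root P z.
  by rewrite /root /P !hornerE mulrC subrr.
have rz : r.[z] = (wronskian p q).[z].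
  have := congr1 (fun s : {poly C} => s^`().[z]) PE.
  rewrite derivM derivXsubC mulr1 !hornerE subrr mulr0 add0r => <-.
  rewrite /P derivB !derivZ /wronskian !hornerE; ring.
have id0 : (fun h : C => h) @ (0 : C)^' --> (0 : C) by exact: nbhs_dnbhs.
have FF : Filter (0 : C)^' by exact: dnbhs_filter.
have shz : (fun h : C => h + z) @ (0 : C)^' --> 0 + z.
  exact (ccvg_add id0 (@ccvg_const _ _ _ _ z)).
rewrite add0r in shz.
have lim_r := ccvg_horner (FF := FF) (p := r) shz.
have lim_q := ccvg_horner (FF := FF) (p := q) shz.
have q2 : q.[z] * q.[z] != 0 by rewrite mulf_neq0.
have L : (fun h => r.[h + z] / (q.[h + z] * q.[z])) @ (0 : C)^' --> r.[z] / (q.[z] * q.[z]).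
  exact (ccvg_mul lim_r (ccvg_inv q2 (ccvg_mul lim_q (@ccvg_const _ _ _ FF q.[z])))).
rewrite rz -expr2 in L.
refine (cvg_trans (near_eq_cvg (FF := FF) _) L).
have q0 : \forall h \near (0 : C)^', q.[h + z] != 0.
  move/cvgrPdist_lt: lim_q => /(_ `|q.[z]|); rewrite normr_gt0 => /(_ qz).
  apply: filterS => h; apply: contraTneq => ->; by rewrite subr0 ltxx.
have h0 : \forall h \near (0 : C)^', h != 0 by exact: nbhs_dnbhs_neq.
apply: filterS2 h0 q0 => h h0 q0.
have := congr1 (fun s : {poly C} => s.[h + z]) PE.
rewrite /P !hornerE addrK => PEh.
have scE (a b : C) : a *: b = a * b by [].
rewrite /shift /= !scE mulr1.
have -> : p.[h + z] / q.[h + z] - p.[z] / q.[z]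
    = (q.[z] * p.[h + z] - p.[z] * q.[h + z]) / (q.[h + z] * q.[z]).
  by field; rewrite q0 qz.
by rewrite PEh; field; rewrite q0 qz h0.
Qed.

Lemma derivable_quotient p q z : q.[z] != 0 ->
  derivable (fun y => p.[y] / q.[y]) z 1.
Proof.
by move=> /(quotient_difference_cvg (p := p)) L; exact (cvgP _ L).
Qed.

Lemma derive_quotient p q z : q.[z] != 0 ->
  'D_1 (fun y => p.[y] / q.[y]) z = (wronskian p q).[z] / q.[z] ^+ 2.
Proof.
by move=> /(quotient_difference_cvg (p := p)) L; apply: (cvg_lim _ L); exact: norm_hausdorff.
Qed.

Definition ratn (b : bool) : {poly C} := if b then rnum else znum.
Definition ratd (b : bool) : {poly C} := if b then rden else zden.

Lemma rden0 : (rden : {poly C}).[0] != 0.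
Proof.
rewrite horner_rden (_ : _ * _ = - (4 * 5 ^+ 5)); last by ring.
by rewrite oppr_eq0 mulf_eq0 expf_eq0 !pnatr_eq0.
Qed.

Lemma zeta14_P1_chart b z : zeta14_P1 (chart b z)
  = if (ratd b).[z] == 0 then None else Some ((ratn b).[z] / (ratd b).[z]).
Proof.
case: b => /=; last by rewrite zden_eq0 zeta14E.
rewrite /chart; have [->|z0] := eqVneq z 0.
  by rewrite (negbTE rden0) horner_rnum expr0n !mul0r.
by rewrite /= zeta14_inv -zden_eq0 rdenE // mulf_eq0 expf_eq0 (negbTE z0).
Qed.

Lemma ratn_ratd_coprime b z : (ratd b).[z] = 0 -> (ratn b).[z] != 0.
Proof.
case: b; last exact: znum_zden_coprime.
have [->|z0] := eqVneq z 0; first by move/eqP; rewrite (negbTE rden0).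
rewrite /= rdenE // rnumE // => /eqP; rewrite mulf_eq0 expf_eq0 (negbTE z0) /=.
by move=> /eqP/znum_zden_coprime h; rewrite mulf_neq0 // expf_neq0.
Qed.

Definition chart_num (b c : bool) := if c then ratd b else ratn b.
Definition chart_den (b c : bool) := if c then ratn b else ratd b.

(** The equality of functions is unrestricted: at zeros of the denominators the convention 0^-1 = 0
    agrees with the value 0 that [coord] takes there. *)
Lemma coord_zeta14_chart b c :
  Defs.coord c \o @zeta14_P1 R \o chart b = fun z => (chart_num b c).[z] / (chart_den b c).[z].
Proof.
apply/funext => z; rewrite /= zeta14_P1_chart.
rewrite /chart_num /chart_den; case: c; case: eqVneq => [d0|d0] //=.
- by rewrite d0 mul0r.
- by rewrite invfM invrK mulrC.
- by rewrite d0 invr0 mulr0.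
Qed.

Lemma range_chart_den b c z :
  range (chart c) (zeta14_P1 (chart b z)) -> (chart_den b c).[z] != 0.
Proof.
rewrite zeta14_P1_chart => -[y _]; case: c => /=.
  case: (eqVneq (ratd b).[z]) => [/ratn_ratd_coprime //|d0].
  by rewrite /chart; case: eqVneq => // y0 [] /eqP; apply: contraTneq => ->;
     rewrite mul0r invr_eq0.
by case: eqVneq.
Qed.

Lemma wronskian_chart b c z :
  (wronskian (chart_num b c) (chart_den b c)).[z] = 0 ->
  (wronskian (ratn b) (ratd b)).[z] = 0.
Proof.
by case: c => //; rewrite /chart_num /chart_den wronskianC hornerN => /eqP; rewrite oppr_eq0 => /eqP.
Qed.

Lemma ramified_zeta14_values x : (wronskian znum zden).[x] = 0 ->
  let f := @zeta14_P1 R in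
  [\/ f (Some x) = Some 0, f (Some x) = Some 1 | f (Some x) = None].
Proof.
rewrite wronskian_zeta14 => /eqP; rewrite mulf_eq0 pnatr_eq0 => /eqP.
move=> /zeta14_crit_values; rewrite /zeta14_P1; case: eqVneq => [_ _|d0]; first exact: Or33.
by case=> [d1|->|[_ ->]]; [rewrite d1 eqxx in d0|exact: Or31|exact: Or32].
Qed.

Lemma ramified_zeta14_P1 (pt : P1 R) : ramified_at (@zeta14_P1 R) pt ->
  let f := @zeta14_P1 R in [\/ f pt = Some 0, f pt = Some 1 | f pt = None].
Proof.
move=> [b [c [z [zp]]]]; rewrite -zp => /range_chart_den d0.
rewrite coord_zeta14_chart derive_quotient // => /eqP.
rewrite mulf_eq0 invr_eq0 expf_eq0 (negbTE d0) andbF orbF => /eqP /wronskian_chart.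
case: b zp d0 => zp d0; last exact: ramified_zeta14_values.
(* The origin of the chart at infinity is infinity itself, which maps to 0; any other point is the
   affine point 1/z, already treated. *)
rewrite /chart; case: eqVneq => [_ _|z0 /=]; first exact: Or31.
rewrite wronskian_zeta14_inv // => /eqP.
rewrite mulf_eq0 mulf_eq0 expf_eq0 (negbTE z0) /= oppr_eq0 pnatr_eq0 => /= /eqP c0.
by apply: ramified_zeta14_values; rewrite wronskian_zeta14 c0 mulr0.
Qed.

(** Used in the degree computation to exhibit ramification points in the exceptional fibres. *)
Lemma ramified_at_chart b c z : (chart_den b c).[z] != 0 ->
  (wronskian (chart_num b c) (chart_den b c)).[z] = 0 ->
  ramified_at (@zeta14_P1 R) (chart b z).
Proof.
move=> d0 w0; exists b, c, z; split => //.
  rewrite zeta14_P1_chart; case: c d0 {w0} => /= d0.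
    case: (eqVneq (ratd b).[z]) => [_|d1].
      by exists 0; rewrite // /chart eqxx.
    exists ((ratn b).[z] / (ratd b).[z])^-1 => //.
    by rewrite /chart invr_eq0 mulf_eq0 invr_eq0 (negbTE d0) (negbTE d1) invrK.
  by rewrite (negbTE d0); exists ((ratn b).[z] / (ratd b).[z]).
by rewrite coord_zeta14_chart derive_quotient // w0 mul0r.
Qed.

End ProjectiveMap.

(** * Neighborhoods of infinity and continuity on the sphere *)

Section SphereTopology.
Context {R : realType}.
Local Notation C := R[i].
Local Notation normc := (@ComplexField.Normc.normc R).

Lemma compact_normc_bounded (K : set C) : compact K ->
  exists M : R, forall z, K z -> normc z <= M.
Proof.
move=> cK.
have cn : {within K, continuous (normc : C -> R)}.
  by apply: continuous_subspaceT; exact: continuous_normc.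
have /compact_bounded[M [_ MK]] := continuous_compact cn cK.
exists (M + 1) => z Kz; apply: le_trans (ler_norm _) _.
by apply: MK; [rewrite ltrDl|exists z].
Qed.

Lemma closed_disc (M : R) : closed [set z : C | normc z <= M].
Proof.
have -> : [set z : C | normc z <= M] = normc @^-1` [set r | r <= M] by [].
by apply: closed_comp => [z _|]; [exact: continuous_normc|exact: closed_le].
Qed.

Lemma compact_disc (M : R) : compact [set z : C | normc z <= M].
Proof.
pose g (u : R * R) : C := u.1 +i* u.2.
pose B := `[- M, M]%classic `*` `[- M, M]%classic.
have gc : continuous g.
  move=> u; refine (@cvg_complexP _ _ (nbhs u) _ _ _ _ _).
    exact (@cvg_fst _ _ (nbhs u.1) (nbhs u.2) _).
  exact (@cvg_snd _ _ (nbhs u.1) (nbhs u.2) _).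
have cgB : compact (g @` B).
  apply: continuous_compact; first exact: continuous_subspaceT.
  by apply: compact_setX; exact: segment_compact.
refine (subclosed_compact (@closed_disc M) cgB _) => -[a b] zM.
exists (a, b) => //; split; rewrite /= in_itv /= -ler_norml.
  exact: le_trans (normc_ge_Re (a +i* b)) zM.
exact: le_trans (normc_ge_Im (a +i* b)) zM.
Qed.

(** Neighborhoods of infinity are given by closed compact sets. Discs are such sets and every
    compact set lies in one, so exteriors of discs suffice; [nbhs_inftyE] is the converse. *)
Lemma nbhs_infty_disc (A : set (P1 R)) (M : R) : A None ->
  (forall z : C, M < normc z -> A (Some z)) -> nbhs (None : P1 R) A.
Proof.
move=> A0 AM; exists [set z : C | normc z <= M].
  by split; [exact: compact_disc|exact: closed_disc].
by move=> y [[z /= zM <-]|-> //]; apply: AM; rewrite ltNge; exact/negP.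
Qed.

Lemma nbhs_inftyE (A : set (P1 R)) : nbhs (None : P1 R) A ->
  A None /\ exists M : R, forall z : C, M < normc z -> A (Some z).
Proof.
move=> [K [cK _] KA]; split; first by apply: KA; right.
have [M KM] := compact_normc_bounded cK.
exists M => z Mz; apply: KA; left; exists z => //= Kz.
by have := KM _ Kz; rewrite leNgt Mz.
Qed.

Lemma continuous_quotient (p q : {poly C}) (z : C) : q.[z] != 0 ->
  (fun y => p.[y] / q.[y]) @ nbhs z --> p.[z] / q.[z].
Proof.
move=> qz; have FF : Filter (nbhs z) by exact: nbhs_filter.
have id_z : (fun y : C => y) @ nbhs z --> z by exact: cvg_id.
exact (ccvg_mul (ccvg_horner (p := p) id_z) (ccvg_inv qz (ccvg_horner (p := q) id_z))).
Qed.

Lemma near_horner_neq0 (q : {poly C}) (z : C) : q.[z] != 0 ->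
  \forall y \near z, q.[y] != 0.
Proof.
move=> qz; have FF : Filter (nbhs z) by exact: nbhs_filter.
have id_z : (fun y : C => y) @ nbhs z --> z by exact: cvg_id.
have /cvgrPdist_lt/(_ `|q.[z]|) := ccvg_horner (FF := FF) (p := q) id_z.
rewrite normr_gt0 => /(_ qz).
by apply: filterS => y; apply: contraTneq => ->; rewrite subr0 ltxx.
Qed.

Lemma continuous_zeta14_P1 : continuous (@zeta14_P1 R).
Proof.
have fE (x : C) : @zeta14_P1 R (Some x) = if zden.[x] == 0 then None else Some (znum.[x] / zden.[x]).
  exact: (zeta14_P1_chart false x).
case=> [x|] A; last first.
  (* At infinity the map is [rnum / rden] in the coordinate 1/y, and a disc of radius [e] there is
     the exterior |y| > 1/e. *)
  have -> : @zeta14_P1 R None = Some 0 by [].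
  move=> A0; have {A0} : \forall y \near (0 : C), A (Some y) by [].
  have L := @continuous_quotient rnum rden 0 rden0.
  rewrite horner_rnum expr0n !mul0r in L.
  move=> /L nA; have nA' : \forall z \near (0 : C), A (Some (rnum.[z] / rden.[z])) by [].
  have [e [e0 Ae]] := (near_normcP _ _).1 (filterI nA' (near_horner_neq0 rden0)).
  apply: (@nbhs_infty_disc _ e^-1) => [|y ye].
    by have [] := Ae 0; rewrite ?subrr ?ComplexField.Normc.normc0 // horner_rnum expr0n !mul0r.
  have ny : 0 < normc y by apply: lt_trans ye; rewrite invr_gt0.
  have y0 : y != 0 by rewrite -normc_gt0.
  have [] := Ae y^-1.
    rewrite subr0 ComplexField.Normc.normcV invf_plt ?posrE //.
  move=> Ay dy; have := zeta14_P1_chart true y^-1.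
  by rewrite /chart invr_eq0 (negbTE y0) invrK /preimage /= => ->; rewrite (negbTE dy).
have [d0|d0] := eqVneq zden.[x] 0.
  have -> : @zeta14_P1 R (Some x) = None by rewrite fE d0 eqxx.
  move=> /nbhs_inftyE[A0 [M AM]].
  have n0 : znum.[x] != 0 by exact: znum_zden_coprime.
  (* At a pole the reciprocal [zden / znum] tends to 0. Below, |M| + 1 replaces M so that the radius
     is positive even for negative M. *)
  have L := @continuous_quotient zden znum x n0; rewrite d0 mul0r in L.
  pose e : R := (`|M| + 1)^-1.
  have e0 : 0 < e by rewrite invr_gt0 ltr_wpDl.
  have /L nE : \forall y \near (0 : C), normc y < e.
    by apply/near_normcP; exists e; split => // y; rewrite subr0.
  have nE' : \forall y \near x, normc (zden.[y] / znum.[y]) < e by [].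
  have : \forall y \near x, A (zeta14_P1 (Some y)).
    apply: filterS2 nE' (near_horner_neq0 n0) => y ye ny; rewrite fE; case: eqVneq => // dy; apply: AM.
    have := ye; rewrite -[_ / _]invrK invfM invrK ComplexField.Normc.normcV.
    rewrite ltf_pV2 ?posrE ?ltr_wpDl // ?normc_gt0 ?mulf_neq0 ?invr_eq0 //.
    rewrite mulrC; apply: le_lt_trans.
    by apply: le_trans (ler_norm M) _; rewrite lerDl.
  by [].
have -> : @zeta14_P1 R (Some x) = Some (znum.[x] / zden.[x]) by rewrite fE (negbTE d0).
move=> A0; have {A0} : \forall y \near znum.[x] / zden.[x], A (Some y) by [].
move=> /(continuous_quotient d0) nA.
have nA' : \forall y \near x, A (Some (znum.[y] / zden.[y])) by [].
have : \forall y \near x, A (zeta14_P1 (Some y)).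
  by apply: filterS2 nA' (near_horner_neq0 d0) => y Ay dy; rewrite fE (negbTE dy).
by [].
Qed.

Lemma belyi_zeta14_P1 : belyi (@zeta14_P1 R).
Proof.
split; last exact: ramified_zeta14_P1.
split; first exact: continuous_zeta14_P1.
move=> b c z /range_chart_den d0; rewrite coord_zeta14_chart.
exact: derivable_quotient.
Qed.

End SphereTopology.

(** * Fibres and the degree *)

Section Degree.
Context {R : realType}.
Local Notation C := R[i].

Let size_lin (a b : C) : b != 0 -> size (a%:P + b%:P * 'X) = 2%N.
Proof.
move=> b0; have -> : a%:P + b%:P * 'X = Poly [:: a; b].
  by rewrite /= !cons_poly_def mul0r add0r mulrC addrC.
by rewrite (@PolyK _ 0).
Qed.

Let size_quad (a b c : C) : c != 0 -> size (a%:P + b%:P * 'X + c%:P * 'X ^+ 2) = 3%N.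
Proof.
move=> c0; have -> : a%:P + b%:P * 'X + c%:P * 'X ^+ 2 = Poly [:: a; b; c].
  by rewrite /= !cons_poly_def mul0r; ring.
by rewrite (@PolyK _ 0).
Qed.

Let size_expE (p : {poly C}) n : p != 0 -> size (p ^+ n) = ((size p).-1 * n).+1.
Proof. by move=> p0; rewrite -size_exp prednK // size_poly_gt0 expf_neq0. Qed.

Lemma size_zden : size (zden : {poly C}) = 16%N.
Proof.
have s1 : size (1%:P - 'X : {poly C}) = 2%N.
  by rewrite -[- 'X]mulN1r -polyC1 -polyCN size_lin // oppr_eq0 oner_neq0.
have s2 : size (1%:P + 10%:P * 'X + 5%:P * 'X ^+ 2 : {poly C}) = 3%N.
  by rewrite size_quad // pnatr_eq0.
have p1 : (1%:P - 'X : {poly C}) != 0 by rewrite -size_poly_gt0 s1.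
have p2 : (1%:P + 10%:P * 'X + 5%:P * 'X ^+ 2 : {poly C}) != 0 by rewrite -size_poly_gt0 s2.
have n4 : (4 : C) != 0 by rewrite pnatr_eq0.
rewrite /zden size_mul ?expf_neq0 ?mulf_neq0 ?expf_neq0 ?polyC_eq0 //.
by rewrite size_Cmul // !size_expE // s1 s2.
Qed.

Lemma size_znum : (size (znum : {poly C}) <= 14)%N.
Proof.
have s1 : size (1%:P - 5%:P * 'X : {poly C}) = 2%N.
  by rewrite -mulNr -polyCN size_lin // oppr_eq0 pnatr_eq0.
have s2 : size (5%:P + 6%:P * 'X + 5%:P * 'X ^+ 2 : {poly C}) = 3%N.
  by rewrite size_quad // pnatr_eq0.
have p1 : (1%:P - 5%:P * 'X : {poly C}) != 0 by rewrite -size_poly_gt0 s1.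
have p2 : (5%:P + 6%:P * 'X + 5%:P * 'X ^+ 2 : {poly C}) != 0 by rewrite -size_poly_gt0 s2.
rewrite /znum size_mul ?mulf_neq0 ?expf_neq0 ?polyX_eq0 //.
by rewrite mulrC size_mulX ?expf_neq0 // !size_expE // s1 s2.
Qed.

(** At a double root both znum = y zden and znum' = y zden' hold, so the Wronskian vanishes and y is
    a critical value; coprimality excludes a pole, and 0 and 1 are excluded by hypothesis. *)
Lemma separable_fibre (y : C) : y != 0 -> y != 1 ->
  separable_poly (znum - y *: zden : {poly C}).
Proof.
move=> y0 y1; rewrite separable_poly.unlock.
apply/(@Pdiv.ClosedField.coprimepP C) => x.
rewrite /root hornerD hornerN hornerZ subr_eq0 => /eqP nx.
have d0 : zden.[x] != 0.
  by apply/eqP => d0; have := znum_zden_coprime d0; rewrite nx d0 mulr0 eqxx.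
apply/negP; rewrite derivB derivZ hornerD hornerN hornerZ subr_eq0 => /eqP dx.
have w0 : (wronskian znum zden).[x] = 0.
  by rewrite /wronskian hornerD hornerN (hornerM _ zden) (hornerM znum) dx nx; ring.
have := ramified_zeta14_values w0.
rewrite /= -zden_eq0 (negbTE d0) zeta14E nx mulfK //.
by case=> [[yE]|[yE]|//]; move: y0 y1; rewrite yE eqxx.
Qed.

(** Over the algebraically closed field R[i], the separable polynomial [znum - y *: zden] of degree
    15 has 15 distinct roots, which make up the fibre. *)
Lemma card_fibre (y : C) : y != 0 -> y != 1 ->
  (@zeta14_P1 R @^-1` [set Some y] #= `I_15)%card.
Proof.
move=> y0 y1; pose p : {poly C} := znum - y *: zden.
have sp : size p = 16%N.
  have sd : size (- (y *: zden) : {poly C}) = 16%N by rewrite size_opp size_scale // size_zden.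
  by rewrite /p addrC size_addl sd // ltnS (leq_trans size_znum).
have [r pE] := closed_field_poly_normal p.
have l0 : lead_coef p != 0 by rewrite lead_coef_eq0 -size_poly_gt0 sp.
have rs : size r = 15%N.
  by have := sp; rewrite pE size_scale // size_prod_XsubC => -[].
have ur : uniq r.
  have := separable_fibre y0 y1; rewrite -/p pE -separable_prod_XsubC.
  by rewrite (eqp_separable (eqp_scale _ l0)).
have rootE x : (x \in r) = (zeta14_P1 (Some x) == Some y :> P1 R).
  rewrite -root_prod_XsubC -(rootZ _ _ l0) -pE /root /p hornerD hornerN hornerZ subr_eq0.
  rewrite /zeta14_P1 -zden_eq0; have [d0|d0] := eqVneq zden.[x] 0.
    by rewrite d0 mulr0 (negbTE (znum_zden_coprime d0)).
  by rewrite zeta14E; apply/eqP/eqP => [->|[<-]]; [rewrite mulfK|rewrite divfK].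
pose s : seq (P1 R) := [seq Some x | x <- r].
have us : uniq s by rewrite map_inj_uniq // => a b [].
have -> : @zeta14_P1 R @^-1` [set Some y] = [set` [fset t | t in s]%fset].
  apply/seteqP; split => [[x|]|t] /=; rewrite ?inE /=.
  - by move=> /eqP; rewrite -rootE => xr; apply/mapP; exists x.
  (* Infinity maps to 0, so y != 0 keeps it out of the fibre. *)
  - by case=> /eqP; rewrite eq_sym (negbTE y0).
  - by case/mapP => x xr ->; apply/eqP; rewrite -rootE.
by apply/card_eq_fsetP; rewrite card_fseq undup_id // size_map.
Qed.

(** The fibres over 0, 1 and infinity each contain a ramification point, so the hypothesis excludes
    them: 1/5 over 0, a root of 1 + 5x^2 + 10x^3 over 1, and the point 1 over infinity. *)
Lemma degree_zeta14_P1 : has_degree (@zeta14_P1 R) 15.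
Proof.
have crit0 (x : C) : zeta14_crit x = 0 -> (wronskian znum zden).[x] = 0.
  by rewrite wronskian_zeta14 => ->; rewrite mulr0.
case=> [y|] unram; last first.
  have d0 : (zden : {poly C}).[1] = 0.
    by rewrite horner_zden /zeta14_den subrr expr0n /= mul0r mulr0.
  case: (unram (chart false 1)); first by rewrite zeta14_P1_chart /= d0 eqxx.
  apply: (@ramified_at_chart _ _ true); first exact: znum_zden_coprime.
  rewrite /chart_num /chart_den /= wronskianC hornerN crit0 ?oppr0 //.
  by rewrite /zeta14_crit subrr expr0n /= mul0r mulr0.
have [y0|y0] := eqVneq y 0.
  pose x : C := 1 / 5; have x5 : 1 - 5 * x = 0 by rewrite /x; field.
  have n0 : znum.[x] = 0 by rewrite horner_znum x5 expr0n /= mulr0 mul0r.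
  have d0 : zden.[x] != 0 by apply/eqP => /znum_zden_coprime; rewrite n0 eqxx.
  case: (unram (chart false x)).
    by rewrite zeta14_P1_chart /= (negbTE d0) n0 mul0r y0.
  apply: (@ramified_at_chart _ _ false) => //.
  by apply: crit0; rewrite /zeta14_crit x5 expr0n /= !mul0r.
have [y1|y1] := eqVneq y 1; last exact: card_fibre.
pose c : {poly C} := 1%:P + 5%:P * 'X ^+ 2 + 10%:P * 'X ^+ 3.
have cE : c = Poly [:: 1; 0; 5; 10].
  by rewrite /= !cons_poly_def mul0r; rewrite /c; ring.
have /closed_rootP[x] : size c != 1%N.
  by rewrite cE (@PolyK _ 0) //= pnatr_eq0.
rewrite /root !(hornerD, hornerM, hornerC, horner_exp, hornerX) => /eqP cx.
have nd : znum.[x] = zden.[x].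
  apply/eqP; rewrite -subr_eq0 horner_znum horner_zden /zeta14_den.
  rewrite -(_ : - ((4 - 5 * x - 10 * x ^+ 2 - 5 * x ^+ 3)
        * (1 - 55 * x - 5 * x ^+ 2 - 5 * x ^+ 3) ^+ 2
        * (1 + 5 * x ^+ 2 + 10 * x ^+ 3) ^+ 2) = 0); first by apply/eqP; ring.
  by rewrite cx expr0n /= mulr0 oppr0.
have d0 : zden.[x] != 0 by apply/eqP => d0; have := znum_zden_coprime d0; rewrite nd d0 eqxx.
case: (unram (chart false x)).
  by rewrite zeta14_P1_chart /= (negbTE d0) nd divff // y1.
apply: (@ramified_at_chart _ _ false) => //.
by apply: crit0; rewrite /zeta14_crit cx mulr0 mulr0 mul0r.
Qed.

End Degree.

Theorem theorem8p14 (R : realType) :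
  [/\ belyi (@zeta14_P1 R),
      has_degree (@zeta14_P1 R) 15,
      (forall x : R[i], x != 0 -> zeta14_den x != 0 ->
        zeta14 x =
          let s := - ((1 - 5 * x) * (5 + 6 * x + 5 * x ^+ 2)) / (64 * x) in
          5 ^+ 5 / 4 ^+ 4 * (s ^+ 4 / (1 - s) ^+ 5)),
      (forall x : R[i], zeta14_den x != 0 ->
        zeta14 x =
          1 - (4 - 5 * x - 10 * x ^+ 2 - 5 * x ^+ 3)
              * (1 - 55 * x - 5 * x ^+ 2 - 5 * x ^+ 3) ^+ 2
              * (1 + 5 * x ^+ 2 + 10 * x ^+ 3) ^+ 2
              / (4 * (1 - x) ^+ 5 * (1 + 10 * x + 5 * x ^+ 2) ^+ 5))
    & \forall x \near (0 : R[i]),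
        hyp43_cvg (- (1 / 20)) (3 / 20) (7 / 20) (11 / 20)
                  (1 / 4) (1 / 2) (3 / 4) (zeta14 x) /\
        cpow (1 - x) (1 / 4) * cpow (1 + 10 * x + 5 * x ^+ 2) (1 / 4)
        * hyp43 (- (1 / 20)) (3 / 20) (7 / 20) (11 / 20)
                (1 / 4) (1 / 2) (3 / 4) (zeta14 x)
        = cpow (1 / 2 - 5 / 16 * x - 5 / 8 * x ^+ 2 - 5 / 16 * x ^+ 3
                + 1 / 2 * cpow (1 - 5 / 4 * x - 5 / 2 * x ^+ 2
                                - 5 / 4 * x ^+ 3) (1 / 2))
               (1 / 4)].
Proof.
split.
- exact: belyi_zeta14_P1.
- exact: degree_zeta14_P1.
- exact: zeta14_s.
- exact: zeta14_one_sub.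
- have FF : Filter (nbhs (0 : R[i])) by exact: nbhs_filter.
  exact (hyp43_near0 (FF := FF) (f := id) (@cvg_id _ (nbhs (0 : R[i])))).
Qed.
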